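(* A bipartite outerplanar graph $G$ is a graph of stably matchable pairs if and only if $G$ has no articulation vertex.
   Context: An articulation vertex of a graph is a vertex whose removal increases the number of connected components. A stable matching instance consists of finite disjoint sets of students and residencies, where each student has a strict linear preference order on a subset of the residencies and each residency has a strict linear preference order on a subset of the students. A matching (set of student–residency pairs, each element in at most one pair) is stable if each of its pairs is mutually acceptable (each member appears in the other's list) and no mutually acceptable pair $(s,r)$ not in it has both $s$ unmatched or preferring $r$ to its partner and $r$ unmatched or preferring $s$ to its partner. The graph of stably matchable pairs of the instance is the bipartite graph whose vertices are all students and residencies and whose edges are the pairs occurring in at least one stable matching. A graph is a graph of stably matchable pairs if it is isomorphic to the graph of stably matchable pairs of some stable matching instance. *)

(* Defs.v *)
From HB Require Import structures.
From mathcomp Require Import all_boot all_order all_algebra.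
From mathcomp Require Import all_classical all_reals all_analysis.

Set Implicit Arguments.
Unset Strict Implicit.
Unset Printing Implicit Defensive.

Import Order.TTheory GRing.Theory Num.Theory.
Import numFieldNormedType.Exports.

Local Open Scope classical_set_scope.
Local Open Scope ring_scope.

(* A finite simple graph is a symmetric irreflexive relation on a finType. *)

Definition bipartite (V : finType) (e : rel V) : Prop :=
  exists side : V -> bool, forall u v, e u v -> side u != side v.

Definition delete_vertex (V : finType) (e : rel V) (x : V) : rel V :=
  [rel u v | [&& u != x, v != x & e u v]].

(* [delete_vertex e x] still lives on V, where x has become isolated;
   restricting the count to [predC1 x] discards the spurious component {x}. *)
Definition articulation_vertex (V : finType) (e : rel V) (x : V) : bool :=
  (n_comp e predT < n_comp (delete_vertex e x) (predC1 x))%N.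

Definition graph_iso (V W : finType) (e : rel V) (e' : rel W) : Prop :=
  exists2 f : V -> W, bijective f & {mono f : u v / e u v >-> e' u v}.

Section Drawing.
Variables (R : realType) (V : finType) (e : rel V).

(* [pos] places the vertices; for adjacent u and v, [arc u v] restricted to
   [0, 1] is a simple arc from u to v, and [arc v u] is its reversal, so that
   both represent the single undirected edge uv. *)
Record planar_drawing (pos : V -> R * R) (arc : V -> V -> R -> R * R) : Prop :=
  PlanarDrawing {
    drawing_pos_inj : injective pos;
    drawing_arc_continuous : forall u v, e u v ->
      {within `[0, 1], continuous (arc u v)};
    drawing_arc_inj : forall u v, e u v ->
      {in `[0, 1] &, injective (arc u v)};
    drawing_arc_start : forall u v, e u v -> arc u v 0 = pos u;
    drawing_arc_end : forall u v, e u v -> arc u v 1 = pos v;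
    drawing_arc_rev : forall u v (t : R), e u v -> t \in `[0, 1] ->
      arc v u t = arc u v (1 - t);
    drawing_arc_vertex : forall u v w (t : R), e u v -> t \in `]0, 1[ ->
      arc u v t != pos w;
    drawing_arc_disjoint : forall u v u' v' (t t' : R), e u v -> e u' v' ->
      t \in `]0, 1[ -> t' \in `]0, 1[ -> arc u v t = arc u' v' t' ->
      [set u; v]%SET = [set u'; v']%SET
  }.

Definition drawing_support (pos : V -> R * R) (arc : V -> V -> R -> R * R) :
    set (R * R) :=
  [set z | (exists v, z = pos v) \/
           exists u v (t : R), [/\ e u v, t \in `[0, 1] & z = arc u v t]].

Definition face (D F : set (R * R)) : Prop :=
  exists2 z, ~ D z & F = connected_component (~` D) z.

(* The support of a drawing is bounded, so its unbounded face is unique. *)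
Definition outer_face (D F : set (R * R)) : Prop :=
  face D F /\ ~ bounded_set F.

(* All vertices lie on the boundary of the outer face: they belong to its
   closure, and not to the face itself since they are in the support. *)
Definition outerplanar : Prop :=
  exists (pos : V -> R * R) (arc : V -> V -> R -> R * R),
    planar_drawing pos arc /\
    exists2 F, outer_face (drawing_support pos arc) F &
               forall v, closure F (pos v).

End Drawing.
Arguments outerplanar R {V} e.

(* A strict linear order on a subset of a finite set is given by the
   duplicate-free list of that subset, most preferred element first. *)
Record instance := Instance {
  student : finType;
  residency : finType;
  student_list : student -> seq residency;
  residency_list : residency -> seq student;
  student_list_uniq : forall s, uniq (student_list s);
  residency_list_uniq : forall r, uniq (residency_list r)
}.

Definition prefers (T : eqType) (l : seq T) (x y : T) : bool :=
  [&& x \in l, y \in l & (index x l < index y l)%N].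

Section StableMatching.
Variable I : instance.
Implicit Types (M : {set student I * residency I}).
Implicit Types (s : student I) (r : residency I).

Definition acceptable s r : bool :=
  (r \in student_list s) && (s \in residency_list r).

Definition matching M : bool :=
  [forall p in M, forall q in M, (p.1 == q.1) || (p.2 == q.2) ==> (p == q)].

Definition student_desires M s r : bool :=
  [forall r', (s, r') \notin M] ||
  [exists r', ((s, r') \in M) && prefers (student_list s) r r'].

Definition residency_desires M r s : bool :=
  [forall s', (s', r) \notin M] ||
  [exists s', ((s', r) \in M) && prefers (residency_list r) s s'].

Definition blocking M s r : bool :=
  [&& acceptable s r, (s, r) \notin M,
      student_desires M s r & residency_desires M r s].

Definition stable M : bool :=
  [&& matching M, [forall p in M, acceptable p.1 p.2] &
      [forall s, forall r, ~~ blocking M s r]].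

Definition stably_matchable s r : bool :=
  [exists M : {set student I * residency I}, stable M && ((s, r) \in M)].

(* The sum type makes the two sides disjoint. *)
Definition stably_matchable_graph : rel (student I + residency I) :=
  fun x y => match x, y with
             | inl s, inr r | inr r, inl s => stably_matchable s r
             | _, _ => false
             end.

End StableMatching.

Definition is_graph_of_stably_matchable_pairs (V : finType) (e : rel V) : Prop :=
  exists I : instance, graph_iso e (@stably_matchable_graph I).

(* Main.v *)
(* If x is adjacent to a and b, compare a stable matching using xa with one
   using xb: both cover the same agents, so if a and b were in different
   components of G - x, counting the covered agents of each side in the
   component of a would give two different answers.

   Conversely, an outerplanar drawing contains no theta, i.e. no three
   internally disjoint paths of length at least 2 with common ends: by a
   parity argument on winding numbers, one of the three closed curves that the
   paths form in pairs winds around a vertex of the remaining path, which is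
   then away from the outer face. Without articulation vertices and thetas,
   a longest cycle of a nontrivial component spans it, and by bipartiteness no
   two chords of it cross. Let every agent prefer its neighbours in the order
   in which it meets them when walking along this cycle. For an edge uv, match
   u with v, one of the two arcs between them along the cycle with the
   successors of its students, and the other one with the predecessors: as
   chords do not cross, this matching is stable. *)

Require Import Defs.
From mathcomp Require Import all_boot all_order all_algebra.
From mathcomp Require Import all_classical all_reals all_analysis.
From mathcomp Require Import zify lra.

Set Implicit Arguments.
Unset Strict Implicit.
Unset Printing Implicit Defensive.

(** * Winding numbers of fine polygonal chains *)

Section PlaneCurves.
Import Order.TTheory GRing.Theory Num.Theory.
Import numFieldNormedType.Exports.
Local Open Scope classical_set_scope.
Local Open Scope ring_scope.

(* Gray code of the four half-open quadrants of the punctured plane: the first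
   bit says "left", the second one "below", and opposite vectors have
   complementary codes. *)
Definition quadrant (R : realType) (v : R * R) : bool * bool :=
  ((v.1 < 0) || (v.1 == 0) && (0 < v.2), (v.2 < 0) || (v.2 == 0) && (v.1 < 0)).

Definition opposite (a b : bool * bool) : bool := (a.1 != b.1) && (a.2 != b.2).

Definition quadrant_index (a : bool * bool) : int :=
  match a with
  | (false, false) => 0 | (true, false) => 1
  | (true, true) => 2 | (false, true) => 3
  end.

(* The number of quarter turns from [a] to [b], with the convention that both
   turns between opposite quadrants count as +2. *)
Definition turn (a b : bool * bool) : int :=
  if opposite a b then 2 else
  if a == b then 0 else
  if (quadrant_index b - quadrant_index a == 1) ||
     (quadrant_index b - quadrant_index a == -3) then 1 else -1.

Lemma turn_mod4 a b :
  exists n : int, turn a b = quadrant_index b - quadrant_index a + 4 * n.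
Proof.
case: a b => [[] []] [[] []];
  solve [by exists 0 | by exists 1 | by exists (- 1)].
Qed.

(** Pairwise non-opposite quadrants take at most two values, which are then adjacent, so no full
    turn can hide in the sum. *)
Lemma turn_triangle a b c : ~~ opposite a b -> ~~ opposite b c ->
  ~~ opposite a c -> turn a b + turn b c = turn a c.
Proof. by case: a b c => [[] []] [[] []] [[] []]. Qed.

Lemma turn_negb a b :
  turn (~~ a.1, ~~ a.2) (~~ b.1, ~~ b.2) = turn a b.
Proof. by case: a b => [[] []] [[] []]. Qed.

Lemma quadrant_index_negb a : exists n : int,
  quadrant_index (~~ a.1, ~~ a.2) = quadrant_index a + 2 + 4 * n.
Proof.
case: a => [[] []]; solve [by exists 0 | by exists 1 | by exists (- 1)].
Qed.

#[local] Arguments quadrant_index : simpl never.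
#[local] Arguments quadrant : simpl never.
#[local] Arguments turn : simpl never.

Section Turning.
Variable R : realType.
Implicit Types (p q x y v w : R * R) (s : seq (R * R)).

Lemma quadrantN v : v != 0 ->
  quadrant (- v) = (~~ (quadrant v).1, ~~ (quadrant v).2).
Proof.
case: v => a b; rewrite /quadrant /= !oppr_lt0 !oppr_eq0 !oppr_gt0 => nz.
have {nz} : (a != 0) || (b != 0) by rewrite -negb_and;
  apply: contraNN nz => /andP[/eqP-> /eqP->].
by case: (ltgtP a 0); case: (ltgtP b 0).
Qed.

(** The norm is the maximum norm. Between opposite quadrants both coordinates weakly change sign, so
    each coordinate of [v - w] is at least as large in absolute value as that of [v]. *)
Lemma opposite_quadrant v w :
  `|v - w| < `|v| -> ~~ opposite (quadrant v) (quadrant w).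
Proof.
case: v w => [a b] [c d]; apply: contraTN; rewrite /opposite /quadrant /=.
rewrite -leNgt !prod_normE /= => /andP[h1 h2].
have h : `|a| <= `|a - c| /\ `|b| <= `|b - d|.
  have side (u w : R) : (u <= 0) && (0 <= w) || (0 <= u) && (w <= 0) ->
      `|u| <= `|u - w|.
    by case/orP=> /andP[? ?]; [rewrite !ler0_norm | rewrite !ger0_norm]; lra.
  by split; apply: side; move: h1 h2; case: (ltgtP a 0); case: (ltgtP b 0);
    case: (ltgtP c 0); case: (ltgtP d 0).
by rewrite ge_max !le_max h.1 h.2 orbT.
Qed.

Fixpoint turning p x s : int :=
  if s is y :: s' then
    turn (quadrant (x - p)) (quadrant (y - p)) + turning p y s'
  else 0.

Lemma turning_cat p x s s' :
  turning p x (s ++ s') = turning p x s + turning p (last x s) s'.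
Proof. by elim: s x => [|y s IH] x; rewrite /= ?add0r // IH addrA. Qed.

Lemma turning_mod4 p x s : exists n : int, turning p x s =
  quadrant_index (quadrant (last x s - p)) - quadrant_index (quadrant (x - p))
  + 4 * n.
Proof.
elim: s x => [|y s IH] x /=; first by exists 0; lia.
have [n ->] := IH y.
have [m ->] := turn_mod4 (quadrant (x - p)) (quadrant (y - p)).
by exists (m + n); lia.
Qed.

Definition step_lt (eta : R) : rel (R * R) := fun x y => `|x - y| < eta.

(* The identity says that the continuous direction of [x - y] has no monodromy
   around the boundary of a rectangle; it uses that [x - y] and [y - x] turn
   alike. *)
Lemma turning_rectangle eta eta' x y s s' :
  path (step_lt eta) x s -> path (step_lt eta') y s' ->
  {in x :: s & y :: s', forall z z', eta + eta' <= `|z - z'|} ->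
  turning y x s + turning (last x s) y s' =
  turning x y s' + turning (last y s') x s.
Proof.
have key a b c d : step_lt eta a b -> step_lt eta' c d ->
    {in [:: a; b] & [:: c; d], forall z z', eta + eta' <= `|z - z'|} ->
  turn (quadrant (a - c)) (quadrant (b - c)) +
    turn (quadrant (c - b)) (quadrant (d - b)) =
  turn (quadrant (c - a)) (quadrant (d - a)) +
    turn (quadrant (a - d)) (quadrant (b - d)).
  rewrite /step_lt => ab cd far.
  have [hac had hbc hbd] : [/\ eta + eta' <= `|a - c|, eta + eta' <= `|a - d|,
    eta + eta' <= `|b - c| & eta + eta' <= `|b - d|].
    by split; apply: far; rewrite !inE eqxx ?orbT.
  have eta0 : 0 < eta by apply: le_lt_trans ab.
  have eta'0 : 0 < eta' by apply: le_lt_trans cd.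
  have nz z z' : eta + eta' <= `|z - z'| -> z - z' != 0.
    by move=> h; apply: contraTneq h => ->; rewrite normr0 -ltNge addr_gt0.
  have opp z z' : eta + eta' <= `|z - z'| -> quadrant (z' - z) =
      (~~ (quadrant (z - z')).1, ~~ (quadrant (z - z')).2).
    by move=> /nz h; rewrite -quadrantN // opprB.
  rewrite (opp _ _ hbc) (opp _ _ hbd) (opp _ _ hac) (opp _ _ had).
  rewrite !turn_negb.
  have small z z' w w' : z \in [:: a; b] -> z' \in [:: a; b] ->
      w \in [:: c; d] -> w' \in [:: c; d] ->
      ~~ opposite (quadrant (z - w)) (quadrant (z' - w')).
    move=> hz hz' hw hw'; apply: opposite_quadrant.
    apply: lt_le_trans (far _ _ hz hw).
    have -> : z - w - (z' - w') = (z - z') - (w - w').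
      by rewrite !opprB addrACA [RHS]addrACA [- w + _]addrC.
    apply: le_lt_trans (ler_normB _ _) _; apply: ltrD.
      move: hz hz'; rewrite !inE.
      by do 2 case/orP => /eqP->; rewrite ?subrr ?normr0 // distrC.
    move: hw hw'; rewrite !inE.
    by do 2 case/orP => /eqP->; rewrite ?subrr ?normr0 // distrC.
  rewrite !turn_triangle //; apply: small; rewrite !inE eqxx ?orbT //.
have row a b y0 s0 : step_lt eta a b -> path (step_lt eta') y0 s0 ->
    {in [:: a; b] & y0 :: s0, forall z z', eta + eta' <= `|z - z'|} ->
    turn (quadrant (a - y0)) (quadrant (b - y0)) + turning b y0 s0 =
    turning a y0 s0 +
      turn (quadrant (a - last y0 s0)) (quadrant (b - last y0 s0)).
  elim: s0 y0 => [|c s0 IH] y0 ab /=; first by rewrite addr0 add0r.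
  case/andP=> yc cs far; rewrite addrA key //; last first.
    by move=> z z' hz hz'; apply: far => //; move: hz'; rewrite !inE orbA => ->.
  rewrite -addrA IH ?addrA // => z z' hz hz'.
  by apply: far => //; rewrite inE hz' orbT.
move=> + ys; elim: s x => [|z s IH] x /=; first by rewrite add0r addr0.
case/andP=> xz zs far.
have far1 : {in [:: x; z] & y :: s', forall z z', eta + eta' <= `|z - z'|}.
  by move=> u v hu; apply: far; move: hu; rewrite !inE orbA => ->.
rewrite -addrA IH // => [|u v hu]; last by apply: far; rewrite inE hu orbT.
by rewrite addrA (row x z) // addrA.
Qed.

(** Apply [turning_rectangle] to each chain and the single step from [p] to [q]: the correction
    terms depend only on the common ends and cancel. The factor 3 leaves the distance [2 * eta] from
    [q] that this identity requires. *)
Lemma winding_local eta x x' s s' p q : 0 < eta ->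
  path (step_lt eta) x s -> path (step_lt eta) x' s' ->
  x = x' -> last x s = last x' s' -> `|p - q| < eta ->
  {in x :: s, forall z, 3%:R * eta <= `|z - p|} ->
  {in x' :: s', forall z, 3%:R * eta <= `|z - p|} ->
  turning p x s - turning p x' s' = turning q x s - turning q x' s'.
Proof.
move=> eta0 hs hs' xx' ll pq far far'; rewrite -{}xx' in hs' ll far' *.
have base s0 : path (step_lt eta) x s0 ->
    {in x :: s0, forall z, 3%:R * eta <= `|z - p|} ->
    turning p x s0 + turning (last x s0) p [:: q] =
    turning x p [:: q] + turning q x s0.
  move=> h0 f0; apply: (@turning_rectangle eta eta) => //=;
    first by rewrite /step_lt pq.
  move=> z z' /f0 hz; rewrite !inE => /orP[] /eqP->; first lra.
  have : `|z - p| <= `|z - q| + `|q - p| by rewrite -[z - p](subrKA q)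
    ler_normD.
  rewrite (distrC q p); lra.
have := base _ hs far; have := base _ hs' far'; rewrite -ll; lia.
Qed.

(** Within a half-plane a turn is a difference of potentials, so turns telescope along a chain. *)
Lemma turn_fst_const b : exists g, forall c c',
  turn (b, c) (b, c') = g c' - g c.
Proof.
exists (fun c : bool => if b then c%:R else - c%:R).
by case: b => [] [] [].
Qed.

Lemma turn_snd_const b : exists g, forall c c',
  turn (c, b) (c', b) = g c' - g c.
Proof.
exists (fun c : bool => if b then - c%:R else c%:R).
by case: b => [] [] [].
Qed.

(** Seen from [p], the open square of radius [M] lies in one half-plane, where the turning depends
    only on the end points of the chain. *)
Lemma winding_far x x' s s' p M :
  {in x :: s, forall z, `|z| < M} -> {in x' :: s', forall z, `|z| < M} ->
  M <= `|p| -> x = x' -> last x s = last x' s' ->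
  turning p x s = turning p x' s'.
Proof.
move=> small small' far xx' ll; rewrite -{}xx' in ll small' *.
suff [g Hg] : exists g : R * R ->
  int, forall x s, {in x :: s, forall z, `|z| < M} ->
    turning p x s = g (last x s) - g x.
  by rewrite !Hg // ll.
suff [g Hg] : exists g : R * R -> int, forall x y, `|x| < M -> `|y| < M ->
    turn (quadrant (x - p)) (quadrant (y - p)) = g y - g x.
  exists g => y0 s0; elim: s0 y0 => [|y s0 IH] y0 sm /=; first by rewrite subrr.
  rewrite Hg; last 2 first.
  - by apply: sm; rewrite !inE eqxx.
  - by apply: sm; rewrite !inE eqxx orbT.
  by rewrite IH => [|z hz]; [rewrite addrC addrA subrK | apply: sm;
    rewrite inE hz orbT].
have fst_const b : (forall z, `|z| < M -> (quadrant (z - p)).1 = b) ->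
    exists g : R * R -> int, forall x y, `|x| < M -> `|y| < M ->
    turn (quadrant (x - p)) (quadrant (y - p)) = g y - g x.
  move=> Hb; have [g Hg] := turn_fst_const b.
  exists (fun z => g (quadrant (z - p)).2) => u v /Hb hu /Hb hv.
  by rewrite -Hg -{1}hu -hv -!surjective_pairing.
have snd_const b : (forall z, `|z| < M -> (quadrant (z - p)).2 = b) ->
    exists g : R * R -> int, forall x y, `|x| < M -> `|y| < M ->
    turn (quadrant (x - p)) (quadrant (y - p)) = g y - g x.
  move=> Hb; have [g Hg] := turn_snd_const b.
  exists (fun z => g (quadrant (z - p)).1) => u v /Hb hu /Hb hv.
  by rewrite -Hg -{1}hu -hv -!surjective_pairing.
move: far; rewrite prod_normE le_max; case: p fst_const snd_const => a b /= F S.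
have bound z : `|z| < M -> [/\ - M < z.1, z.1 < M, - M < z.2 & z.2 < M].
  by rewrite prod_normE gt_max !ltr_norml => /andP[/andP[? ?] /andP[? ?]].
rewrite /quadrant /= in F S.
case/orP; [case: (lerP 0 a) => a0 | case: (lerP 0 b) => b0].
- rewrite ger0_norm // => far; apply: (F true) => -[c d] /bound /= [h1 h2 _ _].
  by rewrite subr_lt0 (_ : _ < _ = true) //; lra.
- rewrite ltr0_norm // => far; apply: (F false) => -[c d] /bound /= [h1 h2 _ _].
  by rewrite lt_gtF ?gt_eqF //; lra.
- rewrite ger0_norm // => far; apply: (S true) => -[c d] /bound /= [_ _ h1 h2].
  by rewrite subr_lt0 (_ : _ < _ = true) //; lra.
- rewrite ltr0_norm // => far; apply: (S false) => -[c d] /bound /= [_ _ h1 h2].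
  by rewrite lt_gtF ?gt_eqF //; lra.
Qed.

End Turning.

(* The three winding numbers of the closed curves [A i ++ B i] - [A j ++ B j]
   around the remaining [m k] add up to an odd number of full turns. *)
Lemma theta_winding (R : realType) (eta : R) (a b : R * R) (m : 'I_3 -> R * R)
    (A B : 'I_3 -> seq (R * R)) :
  0 < eta ->
  (forall i, path (step_lt eta) a (A i) /\ last a (A i) = m i) ->
  (forall i, path (step_lt eta) (m i) (B i) /\ last (m i) (B i) = b) ->
  (forall i j, i != j ->
     {in a :: A i & m j :: B j, forall z z', eta + eta <= `|z - z'|}) ->
  ~ (forall i j k, uniq [:: i; j; k] ->
       turning (m k) a (A i ++ B i) = turning (m k) a (A j ++ B j)).
Proof.
move=> eta0 pA pB far wind.
have rect i j : i != j -> turning (m j) a (A i) + turning (m i) (m j) (B j) =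
    turning a (m j) (B j) + turning b a (A i).
  move=> /far h; have := turning_rectangle (pA i).1 (pB j).1 h.
  by rewrite (pA i).2 (pB j).2.
have split i k : turning (m k) a (A i ++ B i) =
    turning (m k) a (A i) + turning (m k) (m i) (B i).
  by rewrite turning_cat (pA i).2.
have mod4 i k : exists n : int, turning (m k) (m i) (B i) =
    quadrant_index (quadrant (b - m k)) -
    quadrant_index (quadrant (m i - m k)) + 4 * n.
  by have [n] := turning_mod4 (m k) (m i) (B i); rewrite (pB i).2; exists n.
have opp i j : i != j -> exists n : int, quadrant_index (quadrant (m i - m j)) =
    quadrant_index (quadrant (m j - m i)) + 2 + 4 * n.
  move=> ij; have [n nE] := quadrant_index_negb (quadrant (m j - m i)).
  exists n; rewrite -nE -quadrantN ?opprB //; apply/eqP => h0.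
  have := far j i; rewrite eq_sym => /(_ ij (m j) (m i)).
  rewrite -{1}(pA j).2 mem_last mem_head h0 normr0 => /(_ isT isT).
  by rewrite leNgt addr_gt0.
pose i0 := @Ordinal 3 0 isT; pose i1 := @Ordinal 3 1 isT.
pose i2 := @Ordinal 3 2 isT.
(* By the six rectangle identities, the alternating sum of the turnings of the [A i] around the
   [m k] equals that of the [B i]; by [wind] the two add up to 0, so both vanish. But modulo 4 the
   sum for [B] consists of three differences of indices of opposite vectors, each congruent to 2. *)
have := wind i0 i1 i2 isT; have := wind i1 i2 i0 isT; have := wind i2 i0 i1 isT.
rewrite !{}split.
have := rect i0 i1 isT; have := rect i1 i0 isT; have := rect i0 i2 isT.
have := rect i2 i0 isT; have := rect i1 i2 isT; have := rect i2 i1 isT.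
have [n01] := mod4 i0 i1; have [n10] := mod4 i1 i0; have [n02] := mod4 i0 i2.
have [n20] := mod4 i2 i0; have [n12] := mod4 i1 i2; have [n21] := mod4 i2 i1.
have [k01] := opp i0 i1 isT; have [k12] := opp i1 i2 isT.
have [k02] := opp i2 i0 isT.
clear; lia.
Qed.

(** The points of [A] related to [x] form a set that is both open and closed in [A]: near any point,
    being related to [x] neither appears nor disappears. *)
Lemma connected_chain (T : topologicalType) (A : set T) (P : T -> T -> Prop) :
  connected A -> (forall x y z, P x y -> P y z -> P x z) ->
  (forall x, A x -> P x x /\ (\forall y \near x, A y -> P x y /\ P y x)) ->
  forall x y, A x -> A y -> P x y.
Proof.
move=> cA tr loc x y Ax Ay.
suff : A `&` P x = A by move=> AP; move: Ay; rewrite -AP => -[].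
apply: cA; first by exists x; split => //; apply: (loc x Ax).1.
- exists (interior [set z | A z -> P x z]); first exact: open_interior.
  apply/seteqP; split=> z [Az]; last by move=> /nbhs_singleton /(_ Az).
  move=> Pxz; split=> //; apply: filterS (loc z Az).2 => w + Aw.
  by case/(_ Aw) => + _; apply: tr.
- exists (~` interior [set z | A z -> ~ P x z]).
    by apply: open_closedC; exact: open_interior.
  apply/seteqP; split=> z [Az].
    by move=> Pxz; split => //= /nbhs_singleton /(_ Az).
  move=> nz; split => //; apply: contrapT => nP; apply: nz.
  apply: filterS (loc z Az).2 => w + Aw Pxw; case/(_ Aw) => _ Pwz.
  by apply: nP; apply: tr Pwz.
Qed.

Lemma compact_disjoint_dist (R : realType) (K L : set (R * R)) :
  compact K -> compact L -> K `&` L = set0 ->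
  exists2 d : R, 0 < d & forall z z', K z -> L z' -> d <= `|z - z'|.
Proof.
move=> cK cL KL.
have [[z0 Kz0]|nK] := pselect (K !=set0); last first.
  by exists 1 => // z z' Kz; case: nK; exists z.
have [[w0 Lw0]|nL] := pselect (L !=set0); last first.
  by exists 1 => // z z' _ Lz; case: nL; exists z'.
have [| |c] := @compact_EVT_min _ R (fun z =>
  `|z.1 - z.2|) (K `*` L) _ (compact_setX cK cL).
- by exists (z0, w0).
- apply: continuous_subspaceT => z; apply: cvg_norm; apply: cvgB.
    exact: cvg_fst.
  exact: cvg_snd.
rewrite inE => -[Kc Lc] minc; exists `|c.1 - c.2|.
  rewrite normr_gt0 subr_eq0; apply/eqP => cc.
  by have : (K `&` L) c.1; [split => //; rewrite cc | rewrite KL].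
by move=> z z' Kz Lz'; apply: (minc (z, z')); rewrite inE.
Qed.

(** Being joined by a fine chain on the curve is transitive, and it holds locally by continuity;
    connectedness of the interval does the rest. *)
Lemma within_chain (R : realType) (f : R -> R * R) (eta : R) :
  0 < eta -> {within `[0, 1], continuous f} ->
  exists s, [/\ path (step_lt eta) (f 0) s, last (f 0) s = f 1 &
    forall z, z \in f 0 :: s -> exists2 t, t \in `[0, 1] & z = f t].
Proof.
move=> eta0 cf.
pose P (x y : R) := exists s, [/\ path (step_lt eta) (f x) s,
  last (f x) s = f y &
    forall z, z \in s -> exists2 t, t \in `[0, 1] & z = f t].
suff [s [h1 h2 h3]] : P 0 1.
  exists s; split => // z; rewrite inE => /orP[/eqP->|/h3 //].
  by exists 0; rewrite // in_itv /= lexx ler01.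
apply: (connected_chain (@segment_connected R 0 1)).
- move=> x y z [s [h1 h2 h3]] [s' [h1' h2' h3']]; exists (s ++ s'); split.
  + by rewrite cat_path h1 h2.
  + by rewrite last_cat h2.
  + by move=> w; rewrite mem_cat => /orP[/h3|/h3'].
- move=> x Ax; split; first by exists [::].
  have H : within `[0, 1] (nbhs x) [set y | `|f x - f y| < eta].
    rewrite (nbhs_subspace_in Ax).
    by have /cvgr_dist_lt /(_ eta eta0) := cf x.
  move: H; rewrite /within /=; apply: filterS => y /= H Ay; have {}H := H Ay.
  split.
    exists [:: f y]; split => //=; first by rewrite /step_lt H.
    by move=> z; rewrite inE => /eqP->; exists y.
  exists [:: f x]; split => //=; first by rewrite /step_lt distrC H.
  by move=> z; rewrite inE => /eqP->; exists x.
- by rewrite /= in_itv /= lexx ler01.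
- by rewrite /= in_itv /= lexx ler01.
Qed.

(** * Outerplanar drawings contain no theta *)

Section OuterplanarDrawing.
Variables (R : realType) (V : finType) (e : rel V).
Variables (pos : V -> R * R) (arc : V -> V -> R -> R * R).
Hypothesis drawing : planar_drawing e pos arc.

(* The curve of a non-edge, in particular of a pair (u, u), is reduced to the
   first vertex, so that vertices need no separate treatment. *)
Definition edge_curve (uv : V * V) : set (R * R) :=
  if e uv.1 uv.2 then arc uv.1 uv.2 @` `[0, 1] else [set pos uv.1].

Definition drawn_on (S : {pred V}) (z : R * R) : Prop :=
  exists u v, [/\ u \in S, v \in S & edge_curve (u, v) z].

Lemma edge_curve_compact uv : compact (edge_curve uv).
Proof.
rewrite /edge_curve; case: ifP => [uv_e|_]; last exact: compact_set1.
apply: continuous_compact; last exact: segment_compact.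
exact: drawing_arc_continuous drawing _ _ uv_e.
Qed.

Lemma edge_curve_refl v : edge_curve (v, v) (pos v).
Proof.
rewrite /edge_curve /=; case: ifP => // vv.
by exists 0; rewrite ?(drawing_arc_start drawing) //= in_itv /= lexx ler01.
Qed.

Lemma edge_curveP u v z : edge_curve (u, v) z ->
  z = pos u \/ e u v /\
  (z = pos v \/ exists2 t, t \in `]0, 1[ & z = arc u v t).
Proof.
rewrite /edge_curve /=; case: ifP => [uv_e [t /=]|_ ->]; last by left.
rewrite in_itv /= => /andP[t0 t1] <-.
move: t0; rewrite le_eqVlt => /orP[/eqP<-|t0].
  by left; rewrite (drawing_arc_start drawing).
right; split=> //; move: t1; rewrite le_eqVlt => /orP[/eqP->|t1].
  by left; rewrite (drawing_arc_end drawing).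
by right; exists t => //; rewrite in_itv /= t0 t1.
Qed.

Lemma edge_curve_disjoint u v u' v' :
  {in [:: u; v], forall w, w \notin [:: u'; v']} ->
  edge_curve (u, v) `&` edge_curve (u', v') = set0.
Proof.
move=> dis; apply/seteqP; split=> z // [/edge_curveP h /edge_curveP h'].
have uv_neq x y : x \in [:: u; v] -> y \in [:: u'; v'] -> pos x != pos y.
  move=> hx hy; apply/eqP => /(drawing_pos_inj drawing) xy.
  by have := dis _ hx; rewrite xy hy.
have mem x y w : w = x \/ w = y -> w \in [set x; y]%SET.
  by rewrite !inE => -[] ->; rewrite eqxx ?orbT.
have {h} h : (exists2 w, w \in [:: u; v] & z = pos w) \/
    (e u v /\ exists2 t, t \in `]0, 1[ & z = arc u v t).
  case: h => [->|[uv [->|ht]]]; last by right.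
    by left; exists u; rewrite ?inE ?eqxx.
  by left; exists v; rewrite ?inE ?eqxx ?orbT.
have {h'} h' : (exists2 w, w \in [:: u'; v'] & z = pos w) \/
    (e u' v' /\ exists2 t, t \in `]0, 1[ & z = arc u' v' t).
  case: h' => [->|[uv [->|ht]]]; last by right.
    by left; exists u'; rewrite ?inE ?eqxx.
  by left; exists v'; rewrite ?inE ?eqxx ?orbT.
case: h => [[w hw zw]|[uv [t ht zt]]];
  case: h' => [[w' hw' zw']|[uv' [t' ht' zt']]].
- by have := uv_neq _ _ hw hw'; rewrite -zw zw' eqxx.
- by have /eqP[] := drawing_arc_vertex drawing w uv' ht'; rewrite -zt'.
- by have /eqP[] := drawing_arc_vertex drawing w' uv ht; rewrite -zt.
have E := drawing_arc_disjoint drawing uv uv' ht ht' (etrans (esym zt) zt').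
have := dis u; rewrite mem_head => /(_ isT); move/setP: E => /(_ u).
by rewrite !inE eqxx /= => <-.
Qed.

(** There are finitely many pairs of edge curves, so the least distance between disjoint ones serves
    all vertex sets at once. *)
Lemma drawn_on_separated : exists2 d : R, 0 < d &
  forall (S S' : {pred V}) z z', {in S, forall w, w \notin S'} ->
    drawn_on S z -> drawn_on S' z' ->
  d <= `|z - z'|.
Proof.
pose P (k : (V * V) * (V * V)) (d : R) :=
  {in [:: k.1.1; k.1.2], forall w, w \notin [:: k.2.1; k.2.2]} ->
  forall z z', edge_curve k.1 z -> edge_curve k.2 z' -> d <= `|z - z'|.
have [d [d0 H]] : exists d : R, 0 < d /\ forall k, P k d.
  have : \forall d \near 0^'+, 0 < d /\ forall k, P k d.
    apply: filterI; first exact: nbhs_right_gt.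
    apply: (@filter_forall R _ P (0^'+) _) => -[[u v] [u' v']]; rewrite /P /=.
    have [dis|ndis] := pselect {in [:: u; v], forall w, w \notin [:: u'; v']};
      last by apply: nearW.
    have [d0 d00 H] := compact_disjoint_dist (@edge_curve_compact (u, v))
      (@edge_curve_compact (u', v')) (edge_curve_disjoint dis).
    apply: filterS (nbhs_right_le d00) => d dd0 _ z z' Kz Kz'.
    exact: le_trans dd0 (H _ _ Kz Kz').
  by case/filter_ex=> d; exists d.
exists d => // S S' z z' dis [u [v [Su Sv K]]] [u' [v' [Su' Sv' K']]].
apply: (H ((u, v), (u', v'))) => //=.
move=> w; rewrite !inE => /orP[] /eqP->; apply/norP; split; apply/eqP => E.
- by have := dis _ Su; rewrite E Su'.
- by have := dis _ Su; rewrite E Sv'.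
- by have := dis _ Sv; rewrite E Su'.
- by have := dis _ Sv; rewrite E Sv'.
Qed.

Lemma drawn_on_support S z : drawn_on S z -> drawing_support e pos arc z.
Proof.
case=> u [v [_ _]]; rewrite /edge_curve /=; case: ifP => [uv [t ht <-]|_ ->].
  by right; exists u, v, t.
by left; exists u.
Qed.

Lemma drawing_support_bounded : exists M : R,
  forall z, drawing_support e pos arc z -> `|z| < M.
Proof.
pose P uv (M : R) := forall z, edge_curve uv z -> `|z| <= M.
have : \forall M \near +oo, forall uv, P uv M.
  apply: (@filter_forall R _ P (+oo) _) => uv.
  exact: compact_bounded (@edge_curve_compact uv).
case/filter_ex=> M H; exists (M + 1) => z hz.
suff zM : `|z| <= M by apply: le_lt_trans zM _; rewrite ltrDl.
case: hz => [[v ->]|[u [v [t [uv ht ->]]]]].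
  exact: (H (v, v)) (edge_curve_refl v).
by apply: (H (u, v)); rewrite /edge_curve /= uv; exists t.
Qed.

Lemma path_chain (eta : R) a p : 0 < eta -> path e a p ->
  exists s, [/\ path (step_lt eta) (pos a) s, last (pos a) s = pos (last a p) &
    forall z, z \in pos a :: s -> drawn_on (mem (a :: p)) z].
Proof.
move=> eta0; elim: p a => [|b p IH] a.
  move=> _; exists [::]; split => // z; rewrite inE => /eqP->.
  by exists a, a; rewrite !inE eqxx; split => //; exact: edge_curve_refl.
case/andP=> ab /IH[s' [h1' h2' h3']].
have [s [h1 h2 h3]] := within_chain eta0 (drawing_arc_continuous drawing ab).
rewrite (drawing_arc_start drawing ab) (drawing_arc_end drawing ab) in h1 h2 h3.
exists (s ++ s'); split.
- by rewrite cat_path h1 h2.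
- by rewrite last_cat h2.
move=> z; rewrite -cat_cons mem_cat => /orP[/h3[t ht ->]|hz].
  exists a, b; rewrite !inE !eqxx orbT; split => //.
  by rewrite /edge_curve /= ab; exists t.
have [u [v [hu hv K]]] : drawn_on (mem (b :: p)) z.
  by apply: h3'; rewrite inE hz orbT.
by exists u, v; split => //; rewrite inE; apply/orP; right.
Qed.

Let D := drawing_support e pos arc.

(** Two chains with common ends form a closed curve, and only the turning around such curves can be
    compared between [p] and [q]. The bound [eta] may depend on [p] and [q], which makes the
    relation provable locally and still transitive. *)
Definition same_winding (p q : R * R) : Prop :=
  exists2 eta : R, 0 < eta & forall x s s',
    path (step_lt eta) x s -> path (step_lt eta) x s' -> last x s = last x s' ->
    {in x :: s, forall z, D z} -> {in x :: s', forall z, D z} ->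
    turning p x s - turning p x s' = turning q x s - turning q x s'.

Lemma same_winding_trans p q r :
  same_winding p q -> same_winding q r -> same_winding p r.
Proof.
move=> [h h0 H] [k k0 K]; exists (Num.min h k); first by rewrite lt_min h0.
have sub l : Num.min h k <= l -> subrel (@step_lt R (Num.min h k)) (step_lt l).
  by move=> hl x y xy; apply: lt_le_trans xy hl.
move=> x s s' ps ps' ll sD s'D; rewrite H ?K //.
all: try by apply: sub_path ps; apply: sub; rewrite ge_min lexx ?orbT.
all: by apply: sub_path ps'; apply: sub; rewrite ge_min lexx ?orbT.
Qed.

Lemma off_support_dist p : ~ D p ->
  exists2 r : R, 0 < r & forall z, D z -> r <= `|z - p|.
Proof.
move=> nDp.
pose P uv (r : R) := forall z, edge_curve uv z -> r <= `|z - p|.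
have [r [r0 H]] : exists r : R, 0 < r /\ forall uv, P uv r.
  have : \forall r \near 0^'+, 0 < r /\ forall uv, P uv r; last first.
    by case/filter_ex=> r; exists r.
  apply: filterI; first exact: nbhs_right_gt.
  apply: (@filter_forall R _ P (0^'+) _) => -[u v].
  have Kp : edge_curve (u, v) `&` [set p] = set0.
    apply/seteqP; split=> z // [Kz zp]; apply: nDp; rewrite -zp.
    by apply: (@drawn_on_support predT); exists u, v.
  have [d d0 H] := compact_disjoint_dist (@edge_curve_compact (u, v))
    (@compact_set1 _ p) Kp.
  apply: filterS (nbhs_right_le d0) => r rd z Kz.
  by apply: le_trans rd (H _ _ Kz _).
exists r => // z [[v ->]|[u [v [t [uv ht ->]]]]].
  exact: (H (v, v)) (edge_curve_refl v).
by apply: (H (u, v)); rewrite /edge_curve /= uv; exists t.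
Qed.

Lemma step_lt_path (eta eta' : R) x s :
  eta <= eta' -> path (step_lt eta) x s -> path (step_lt eta') x s.
Proof. by move=> h; apply: sub_path => y z yz; apply: lt_le_trans yz h. Qed.

(** Winding numbers are locally constant off the support, hence constant on the connected face, and
    they vanish at its far points. *)
Lemma outer_face_winding F p : outer_face D F -> F p ->
  exists2 eta : R, 0 < eta & forall x s s',
    path (step_lt eta) x s -> path (step_lt eta) x s' -> last x s = last x s' ->
    {in x :: s, forall z, D z} -> {in x :: s', forall z, D z} ->
    turning p x s = turning p x s'.
Proof.
move=> [[z0 nDz0 FE] Funb] Fp.
have cF : connected F by rewrite FE; exact: component_connected.
have FD q : F q -> ~ D q by rewrite FE => /connected_component_sub.
have [M DM] := drawing_support_bounded.
(* The face is unbounded, so it has a point beyond the whole drawing. *)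
have [q Fq Mq] : exists2 q, F q & M <= `|q|.
  apply: contrapT => h; apply: Funb.
  apply: filterS (nbhs_pinfty_ge (num_real M)) => N MN q Fq.
  by apply: le_trans MN; rewrite leNgt; apply/negP => /ltW Mq; apply: h;
    exists q.
have [] : same_winding p q.
  apply: (connected_chain cF _ _ Fp Fq); first exact: same_winding_trans.
  move=> x Fx; split; first by exists 1.
  have [r r0 rD] := off_support_dist (FD _ Fx).
  have r30 : 0 < r / 3 by rewrite divr_gt0.
  apply: filterS (nbhsx_ballx (x : R * R) _ r30) => y /= xy _.
  suff H : forall x0 s s', path (step_lt (r / 3)) x0 s ->
      path (step_lt (r / 3)) x0 s' -> last x0 s = last x0 s' ->
      {in x0 :: s, forall z, D z} -> {in x0 :: s', forall z, D z} ->
      turning x x0 s - turning x x0 s' = turning y x0 s - turning y x0 s'.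
    split; exists (r / 3) => // x0 s s' h1 h2 h3 h4 h5.
    by apply: esym; apply: H.
  move=> x0 s s' h1 h2 h3 h4 h5.
  have r3 : 3 * (r / 3) = r by rewrite mulrC divfK // pnatr_eq0.
  apply: (winding_local r30 h1 h2) => //.
  - by move: xy; rewrite prod_norm_ball.
  - by move=> z /h4 Dz; rewrite r3 rD.
  - by move=> z /h5 Dz; rewrite r3 rD.
move=> eta eta0 H; exists eta => // x s s' h1 h2 h3 h4 h5.
have /eqP := H x s s' h1 h2 h3 h4 h5.
rewrite (@winding_far _ x x s s' q M) //; last 2 first.
- by move=> z /h4 /DM.
- by move=> z /h5 /DM.
by rewrite subrr subr_eq0 => /eqP.
Qed.

(** The list [p i] holds the internal vertices of the [i]-th path. Each path is cut at its first
    internal vertex [h i]; as all [h k] lie on the boundary of the outer face, no closed curve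
    formed by the other two paths winds around them, against [theta_winding]. *)
Lemma outer_theta_free F a b (p : 'I_3 -> seq V) :
  outer_face D F -> (forall v, closure F (pos v)) ->
  a != b -> (forall i, [/\ p i != [::], a \notin p i & b \notin p i]) ->
  (forall i, path e a (rcons (p i) b)) ->
  ~ (forall i j, i != j -> {in p i, forall w, w \notin p j}).
Proof.
move=> outF clF ab pP pp dis.
pose h i := head a (p i); pose q i := behead (p i).
have pE i : p i = h i :: q i by rewrite /h /q; case: (p i) (pP i) => [|? ?] [].
have [d d0 sep] := drawn_on_separated.
have d30 : 0 < d / 3 by rewrite divr_gt0.
have d3 : 3 * (d / 3) = d by rewrite mulrC divfK // pnatr_eq0.
(* Chains on the drawing at distance at least [d] from [pos (h k)] do not wind around it. The bound
   on the step is found for each [k] separately and then made common. *)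
pose Q (k : 'I_3) (eta : R) := forall x s s',
  path (step_lt eta) x s -> path (step_lt eta) x s' -> last x s = last x s' ->
  {in x :: s, forall z, D z /\ d <= `|z - pos (h k)|} ->
  {in x :: s', forall z, D z /\ d <= `|z - pos (h k)|} ->
  turning (pos (h k)) x s = turning (pos (h k)) x s'.
have [eta [eta0 etad HQ]] : exists eta, [/\ 0 < eta, eta <= d / 3 &
    forall k, Q k eta].
  have : \forall eta \near 0^'+, (0 < eta /\ eta <= d / 3) /\ forall k, Q k eta.
    apply: filterI.
      by apply: filterI; [exact: nbhs_right_gt | exact: nbhs_right_le].
    apply: (@filter_forall R _ Q (0^'+) _) => k.
    (* The vertex itself is not in the face, but a face point within [d / 3] has the same winding
       numbers by [winding_local]. *)
    have [pk [Fpk hpk]] := clF (h k) _ (nbhsx_ballx (pos (h k)) _ d30).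
    have [eta1 eta10 H] := outer_face_winding outF Fpk.
    have : \forall eta \near (0 : R)^'+, eta <= d / 3 /\ eta <= eta1.
      by apply: filterI; apply: nbhs_right_le.
    apply: filterS => eta [etad etae] x s s' hs hs' ll far far'.
    have := @winding_local _ (d / 3) x x s s' (pos (h k)) pk d30
      (step_lt_path etad hs) (step_lt_path etad hs') erefl ll.
    rewrite d3 (H x s s' (step_lt_path etae hs) (step_lt_path etae hs') ll).
    + rewrite subrr => /(_ _ _ _) H0; apply/eqP; rewrite -subr_eq0 H0 //.
      - by move: hpk; rewrite prod_norm_ball.
      - by move=> z /far[].
      - by move=> z /far'[].
    + by move=> z /far[].
    + by move=> z /far'[].
  by case/filter_ex=> eta [[? ?] ?]; exists eta.
have HA i : exists s, [/\ path (step_lt eta) (pos a) s,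
    last (pos a) s = pos (h i) &
    forall z, z \in pos a :: s -> drawn_on (mem [:: a; h i]) z].
  apply: (@path_chain eta a [:: h i]) => //=; rewrite andbT.
  by have := pp i; rewrite pE /= => /andP[].
have HB i : exists s, [/\ path (step_lt eta) (pos (h i)) s,
    last (pos (h i)) s = pos b &
    forall z, z \in pos (h i) :: s -> drawn_on (mem (rcons (p i) b)) z].
  have := @path_chain eta (h i) (rcons (q i) b) eta0.
  rewrite last_rcons -rcons_cons -pE; apply.
  by have := pp i; rewrite pE /= => /andP[].
have [A {}HA] := choice HA; have [B {}HB] := choice HB.
have hp i : h i \in p i by rewrite pE mem_head.
have ahB i j : i != j -> {in mem [:: a;
  h i], forall w, w \notin mem (rcons (p j) b)}.
  move=> ij w; rewrite !inE mem_rcons inE => /orP[] /eqP->.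
    by have [_ /negPf-> _] := pP j; rewrite orbF.
  rewrite negb_or (dis _ _ ij) // andbT; apply: contraTneq (hp i) => ->.
  by have [] := pP i.
have aB i j : i != j ->
  {in pred1 (h i), forall w, w \notin mem (rcons (p j) b)}.
  by move=> ij w hw; apply: (ahB i j) => //; rewrite !inE in hw *;
    rewrite hw orbT.
have on_vertex v : drawn_on (pred1 v) (pos v).
  by exists v, v; rewrite inE eqxx; split => //; exact: edge_curve_refl.
apply: (@theta_winding _ eta (pos a) (pos b) (fun i => pos (h i)) A B) => //.
- by move=> i; have [] := HA i.
- by move=> i; have [] := HB i.
- move=> i j ij z z' hz hz'; apply: (@le_trans _ _ d); first lra.
  by have [_ _ /(_ _ hz) Hz] := HA i; have [_ _ /(_ _ hz') Hz'] := HB j;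
     apply: sep (ahB _ _ ij) Hz Hz'.
move=> i j k; rewrite /= !inE !negb_or !andbT => /andP[/andP[ij ik] jk].
have far l : l != k -> {in pos a :: A l ++ B l,
    forall z, D z /\ d <= `|z - pos (h k)|}.
  move=> lk z; rewrite -cat_cons mem_cat => hz.
  have [[_ lA hA] [_ _ hB]] := (HA l, HB l).
  have {hz} [/hA hz|/hB hz] : z \in pos a :: A l \/ z \in pos (h l) :: B l.
  + by case/orP: hz => hz; [left | right; rewrite inE hz orbT].
  + split; first exact: drawn_on_support hz.
    apply: sep hz (on_vertex (h k)) => w; rewrite !inE => /orP[] /eqP->.
      by apply: contraTneq (hp k) => <-; have [] := pP k.
    by apply: contraTneq (hp k) => <-; apply: dis lk _ (hp l).
  + split; first exact: drawn_on_support hz.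
    rewrite distrC; apply: sep (on_vertex (h k)) hz.
    by apply: aB; rewrite eq_sym.
have chain l : path (step_lt eta) (pos a) (A l ++ B l).
  by have [[hA lA _] [hB _ _]] := (HA l, HB l); rewrite cat_path hA lA.
apply: HQ => //; try by apply: far.
by have [[_ lA _] [_ lB _]] := (HA i, HB i);
  have [[_ lA' _] [_ lB' _]] := (HA j, HB j);
  rewrite !last_cat lA lA' lB lB'.
Qed.

End OuterplanarDrawing.

Lemma outerplanar_theta_free (R : realType) (V : finType) (e : rel V)
    (a b : V) (p1 p2 p3 : seq V) :
  outerplanar R e -> [&& p1 != [::], p2 != [::] & p3 != [::]] ->
  path e a (rcons p1 b) -> path e a (rcons p2 b) -> path e a (rcons p3 b) ->
  ~ uniq (a :: b :: p1 ++ p2 ++ p3).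
Proof.
move=> [pos [arc [dr [F outF clF]]]] /and3P[n1 n2 n3] h1 h2 h3.
rewrite /= !cat_uniq !inE !mem_cat !negb_or.
case/andP=> /andP[ab /and3P[a1 a2 a3]] /andP[/and3P[b1 b2 b3]].
case/and3P=> _ /hasPn d1 /and3P[_ /hasPn d23 _].
pose p (i : 'I_3) := nth [::] [:: p1; p2; p3] i.
apply: (outer_theta_free dr outF clF ab (p := p)).
- by case=> -[|[|[|]]].
- by case=> -[|[|[|]]].
have d12 w : w \in p1 -> w \notin p2.
  by move=> w1; apply/negP => w2; have := d1 w;
    rewrite mem_cat w2 w1 => /(_ isT).
have d13 w : w \in p1 -> w \notin p3.
  by move=> w1; apply/negP => w2; have := d1 w;
    rewrite mem_cat w2 w1 orbT => /(_ isT).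
have {}d23 w : w \in p2 -> w \notin p3 by move=> w2; apply/negP => /d23;
  rewrite /= w2.
case=> -[|[|[|]]] // i3 [[|[|[|]]]] // j3 _ w wi; apply/negP => wj.
all: move: wi wj; rewrite /p /= => wi wj.
all: have := (d12 w, d13 w, d23 w); rewrite wi wj => -[[h12 h13] h23].
all: by [have := h12 isT | have := h13 isT | have := h23 isT].
Qed.

End PlaneCurves.

(** * Stable matchings and articulation vertices *)

Section Articulation.
Variables (V : finType) (e : rel V).
Hypotheses (e_sym : symmetric e) (e_irr : irreflexive e).

Lemma delete_vertex_sym x : symmetric (delete_vertex e x).
Proof. by move=> u v; rewrite /delete_vertex /= e_sym andbCA. Qed.

Lemma delete_vertex_connect_neq x a b :
  connect (delete_vertex e x) a b -> a != x -> b != x.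
Proof.
case/connectP=> p + ->; elim: p a => [|c p IH] a //=.
by case/andP=> /and3P[_ cx _] /IH h _; apply: h.
Qed.

Lemma delete_vertex_connect_sub x a b :
  connect (delete_vertex e x) a b -> connect e a b.
Proof. by apply: connect_sub => u v /and3P[_ _ /connect1]. Qed.

(** A walk visiting [x] enters and leaves it through neighbours of [x], and these can be joined
    without [x]. *)
Lemma connect_delete_vertex x a b :
  (forall u v, e x u -> e x v -> connect (delete_vertex e x) u v) ->
  a != x -> b != x -> connect e a b -> connect (delete_vertex e x) a b.
Proof.
move=> nbr ax bx ab.
(* Invariant along the walk: while it stands at [x], some neighbour of [x] is reachable from [a]
   without [x]. *)
pose T v := if v == x then [exists p, e x p && connect (delete_vertex e x) a p]
            else connect (delete_vertex e x) a v.
have {ab} : T b; last by rewrite /T (negPf bx).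
suff TP p v : T v -> path e v p -> T (last v p).
  by case/connectP: ab => p ap ->; apply: TP ap; rewrite /T (negPf ax).
elim: p v => [|w p IH] v //= Tv /andP[vw]; apply: IH.
move: Tv; rewrite /T; case: (eqVneq v x) => [vx|vx].
  case/existsP=> q /andP[xq aq]; rewrite vx in vw.
  have -> : w == x = false by apply: contraTF vw => /eqP->; rewrite e_irr.
  exact: connect_trans aq (nbr _ _ xq vw).
move=> av; case: (eqVneq w x) => [wx|wx].
  by apply/existsP; exists v; rewrite e_sym -{1}wx vw.
by apply: connect_trans av (connect1 _); rewrite /delete_vertex /= vx wx.
Qed.

(** Compare the roots [A] of the components avoiding [x] with the roots [B] of the whole graph:
    [fingraph.root e] maps [A] to [B], and deleting [x] splits no component exactly when this map is
    injective. *)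
Lemma nonarticulationP x :
  reflect (forall a b, e x a -> e x b -> connect (delete_vertex e x) a b)
          (~~ articulation_vertex e x).
Proof.
have cs := sym_connect_sym e_sym.
have ds := sym_connect_sym (delete_vertex_sym x).
pose A := [set r | (fingraph.root (delete_vertex e x) r == r) && (r != x)].
pose B := [set r | fingraph.root e r == r].
have nA : n_comp (delete_vertex e x) (predC1 x) = #|A|.
  by apply: eq_card => r; rewrite !inE.
have nB : n_comp e predT = #|B| by apply: eq_card => r; rewrite !inE andbT.
have nx a : e x a -> a != x by apply: contraTneq => ->; rewrite e_irr.
have rootA a : a != x -> fingraph.root (delete_vertex e x) a \in A.
  move=> ax; rewrite !inE root_root // eqxx.
  exact: delete_vertex_connect_neq (connect_root _ _) ax.
have rootE a : fingraph.root e (fingraph.root (delete_vertex e x) a) =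
  fingraph.root e a.
  apply/eqP; rewrite root_connect // cs.
  exact: delete_vertex_connect_sub (connect_root _ _).
rewrite /articulation_vertex nA nB -leqNgt;
  apply: (iffP idP) => [AB a b xa xb|nbr].
  have BA : B \subset fingraph.root e @: A.
    apply/fintype.subsetP => r; rewrite inE => /eqP rr.
    have [y yx yr] : exists2 y, y != x & fingraph.root e y = r.
      (* The neighbour [a] stands for the component whose root is [x]. *)
      case: (eqVneq r x) => [rx|]; last by exists r.
      exists a; first exact: nx.
      by rewrite -rr rx; apply/eqP; rewrite root_connect // cs connect1.
    by apply/imsetP; exists (fingraph.root (delete_vertex e x) y);
      rewrite ?rootA ?rootE.
  have /imset_injP inj : #|fingraph.root e @: A| == #|A|.
    by rewrite eqn_leq leq_imset_card (leq_trans AB) ?subset_leq_card.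
  rewrite -(root_connect ds); apply/eqP; apply: inj;
    rewrite ?rootA ?nx // !rootE.
  apply/eqP; rewrite root_connect //; apply: connect_trans (connect1 xb).
  by rewrite cs connect1.
have inj : {in A &, injective (fingraph.root e)}.
  move=> r s; rewrite !inE => /andP[/eqP rr rx] /andP[/eqP ss sx] /eqP.
  rewrite root_connect // => rs; rewrite -rr -ss; apply/eqP.
  by rewrite root_connect //; apply: connect_delete_vertex.
rewrite -(card_in_imset inj); apply: subset_leq_card.
by apply/fintype.subsetP => _ /imsetP[r _ ->]; rewrite inE root_root.
Qed.

(** Here [f] and [g] are matchings that cover the same vertices, the uncovered ones being their
    fixed points. The covered part [S] of the component of [f x] is left by [f] only at [f x], and
    by [g] nowhere if [g x] is outside. *)
Lemma matching_pair_connect (side : V -> bool) (f g : V -> V) x :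
  (forall u v, e u v -> side u != side v) ->
  (forall v, f (f v) = v) -> (forall v, g (g v) = v) ->
  (forall v, f v != v -> e v (f v)) -> (forall v, g v != v -> e v (g v)) ->
  (forall v, (f v != v) = (g v != v)) -> f x != x ->
  connect (delete_vertex e x) (f x) (g x).
Proof.
move=> bip fK gK fe ge fg fx; apply/negPn/negP => nconn.
have gx : g x != x by rewrite -fg.
pose S := [pred v | (f v != v) && connect (delete_vertex e x) (f x) v].
have Sx v : v \in S -> v != x.
  by case/andP=> _ /delete_vertex_connect_neq; apply.
have Snext (h : V -> V) v : (forall v, h (h v) = v) ->
    (forall v, h v != v -> e v (h v)) ->
    (forall v, (f v != v) = (h v != v)) -> v \in S -> h v != x -> h v \in S.
  move=> hK he fh Sv hvx; have vx := Sx _ Sv; case/andP: Sv => fv cv.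
  rewrite inE fh hK eq_sym -fh fv /=; apply: connect_trans cv (connect1 _).
  by rewrite /delete_vertex /= vx hvx he // -fh.
pose A := [set v in S | side v == side (f x)].
pose B := [set v in S | side v != side (f x)].
(* No vertex of [A] is matched by [g] to [x], so [g] sends [A] into [B]. *)
have AB : #|A| <= #|B|.
  rewrite -(card_imset _ (can_inj gK)); apply: subset_leq_card.
  apply/fintype.subsetP => _ /imsetP[v + ->]; rewrite inE => /andP[Sv sv].
  rewrite inE Snext //=.
    have := bip _ _ (ge v _); rewrite -fg; case/andP: Sv => -> _ /(_ isT).
    by rewrite (eqP sv) eq_sym.
  apply: contraNneq nconn => gv; rewrite -[X in g X]gv gK.
  by case/andP: Sv.
(* The mate [x] of [f x] under [f] is not in [B], so [f] sends [B] into [A] without reaching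
   [f x]. *)
have : #|B| <= #|A :\ f x|.
  rewrite -(card_imset _ (can_inj fK)); apply: subset_leq_card.
  apply/fintype.subsetP => _ /imsetP[v + ->]; rewrite inE => /andP[Sv sv].
  have fvx : f v != x by apply: contraNneq sv => <-; rewrite fK.
  rewrite !inE (can_eq fK) Sx //=;
    have /= := Snext f v fK fe (fun=> erefl) Sv fvx.
  rewrite !inE => /andP[-> ->] /=.
  have := bip _ _ (fe v _); case/andP: Sv => -> _ /(_ isT).
  by move: sv; case: (side v) (side (f x)) (side (f v)) => [] [] [].
have fxA : f x \in A by rewrite !inE fK eq_sym fx connect0 eqxx.
by move: AB; rewrite (cardsD1 (f x) A) fxA; lia.
Qed.

End Articulation.

(** * Stable matchings as involutions of the agents *)

Section StablePairs.
Variable I : instance.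
Local Notation agent := (student I + residency I)%type.
Implicit Types (M : {set student I * residency I}) (x y z : agent).

Definition adjacent x y : bool :=
  match x, y with
  | inl s, inr r | inr r, inl s => acceptable s r
  | _, _ => false
  end.

Definition agent_prefers x y z : bool :=
  match x, y, z with
  | inl s, inr r, inr r' => prefers (student_list s) r r'
  | inr r, inl s, inl s' => prefers (residency_list r) s s'
  | _, _, _ => false
  end.

(* Unmatched agents are their own mates. *)
Definition mate M x : agent :=
  match x with
  | inl s => if [pick r | (s, r) \in M] is Some r then inr r else inl s
  | inr r => if [pick s | (s, r) \in M] is Some s then inl s else inr r
  end.

Definition desires (m : agent -> agent) x y : bool :=
  (m x == x) || agent_prefers x y (m x).

(** Stability of an involution on all agents, so that one argument serves students and residencies
    alike. *)
Definition stable_mate (m : agent -> agent) : Prop :=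
  [/\ forall x, m (m x) = x, forall x, m x != x -> adjacent x (m x) &
      forall x y, adjacent x y -> m x != y -> desires m x y ->
        ~~ desires m y x].

Lemma adjacent_sym : symmetric adjacent.
Proof. by case=> [s|r] [s'|r']. Qed.

Lemma agent_prefers_total x y z : adjacent x y -> adjacent x z -> y != z ->
  ~~ agent_prefers x y z -> agent_prefers x z y.
Proof.
have total (T : eqType) (l : seq T) a b : a \in l -> b \in l -> a != b ->
    ~~ prefers l a b -> prefers l b a.
  rewrite /prefers => la lb; rewrite la lb /= => ab; rewrite -leqNgt leq_eqVlt.
  case/predU1P=> // E; case/eqP: ab.
  by rewrite -(nth_index a la) -(nth_index a lb) E.
case: x y z => [s|r] [s'|r'] [s''|r''] //= /andP[h1 h2] /andP[h3 h4] ne.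
  by apply: total.
by apply: total.
Qed.

Lemma mate_inlE M s r : stable M -> (mate M (inl s) == inr r) = ((s, r) \in M).
Proof.
case/and3P=> /forall_inP mt _ _ /=; case: pickP => [r' hr'|/(_ r) -> //].
apply/eqP/idP => [[<-] //|hr].
have /forall_inP/(_ _ hr')/implyP/= := mt _ hr; rewrite eqxx => /(_ isT).
by move=> /eqP[->].
Qed.

Lemma mate_inrE M s r : stable M -> (mate M (inr r) == inl s) = ((s, r) \in M).
Proof.
case/and3P=> /forall_inP mt _ _ /=; case: pickP => [s' hs'|/(_ s) -> //].
apply/eqP/idP => [[<-] //|hr].
have /forall_inP/(_ _ hs')/implyP/= := mt _ hr; rewrite eqxx orbT => /(_ isT).
by move=> /eqP[->].
Qed.

Lemma mate_stable M : stable M -> stable_mate (mate M).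
Proof.
move=> sM; split.
- case=> [s|r].
    case E: (mate M (inl s)) => [s'|r]; last first.
      by apply/eqP; rewrite mate_inrE // -mate_inlE // E.
    suff ss' : s = s' by rewrite -ss' E ss'.
    by move: E => /=; case: pickP => // _ [].
  case E: (mate M (inr r)) => [s|r'].
    by apply/eqP; rewrite mate_inlE // -mate_inrE // E.
  suff rr' : r = r' by rewrite -rr' E rr'.
  by move: E => /=; case: pickP => // _ [].
- case/and3P: sM => _ /forall_inP acc _.
  by case=> [s|r] /=; case: pickP => [y /acc //|]; rewrite eqxx.
have key s r : acceptable s r -> (s, r) \notin M ->
    desires (mate M) (inl s) (inr r) -> ~~ desires (mate M) (inr r) (inl s).
  move=> acc nM ds; apply/negP => dr.
  case/and3P: (sM) => _ _ /forallP/(_ s)/forallP/(_ r)/negP; apply.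
  rewrite /blocking acc nM /=; apply/andP; split.
  - rewrite /student_desires;
    case: (pickP [pred r' | (s, r') \in M]) => [r' /= hr'|h].
      apply/orP; right; apply/existsP; exists r'; rewrite hr' /=.
      move: hr' ds; rewrite -mate_inlE // /desires => /eqP ->.
      by [].
    by apply/orP; left; apply/forallP => r';
      rewrite -[_ \in _]/([pred r' | (s, r') \in M] r') h.
  - rewrite /residency_desires;
    case: (pickP [pred s' | (s', r) \in M]) => [s' /= hs'|h].
      apply/orP; right; apply/existsP; exists s'; rewrite hs' /=.
      by move: hs' dr; rewrite -mate_inrE // /desires => /eqP ->.
    by apply/orP; left; apply/forallP => s';
      rewrite -[_ \in _]/([pred s' | (s', r) \in M] s') h.
case=> [s|r] [s'|r'] //= acc; first by rewrite [_ == _]mate_inlE //; exact: key.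
rewrite [_ == _]mate_inrE // => nM dr; apply: contraTN dr; exact: key.
Qed.

Definition agent_side x : bool := if x is inl _ then true else false.

(* The agents preferring [m] to [m'] are sent by [m] injectively to agents of
   the other side preferring [m'] to [m], and conversely: counting shows that
   all of them are matched by both. *)
Lemma stable_mate_matched (m m' : agent -> agent) x :
  stable_mate m -> stable_mate m' -> m x != x -> m' x != x.
Proof.
have adj_side y z : adjacent y z -> agent_side z = ~~ agent_side y.
  by case: y z => [s|r] [s'|r'].
pose P (f g : agent -> agent) c := [set y | [&& agent_side y == c, f y != y,
  f y != g y & desires g y (f y)]].
have key f g c : stable_mate f -> stable_mate g ->
    f @: P f g c \subset [set y in P g f (~~ c) | f y != y].
  move=> [fK fa _] [gK ga gs].
  apply/fintype.subsetP => _ /imsetP[y + ->]; rewrite !inE.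
  case/and4P=> /eqP yc fy fgy dy; have adj := fa _ fy.
  rewrite (adj_side _ _ adj) yc eqxx /= fK [y == _]eq_sym fy.
  have nd : ~~ desires g (f y) y by apply: gs adj _ dy; rewrite eq_sym.
  move: nd; rewrite /desires negb_or => /andP[gfy np]; rewrite gfy fK /= andbT.
  have gy : g (f y) != y by apply: contraNneq fgy => /esym yE; rewrite {2}yE gK.
  rewrite gy (agent_prefers_total _ _ _ np) ?orbT ?ga //;
    last by rewrite eq_sym.
  by rewrite adjacent_sym.
move=> sm sm' mx; apply/eqP => m'x.
have [[mK _ _] [m'K _ _]] := (sm, sm').
pose c := agent_side x.
have xP : x \in P m m' c by rewrite !inE eqxx mx m'x mx /desires m'x eqxx.
have h1 : #|P m m' c| <= #|P m' m (~~ c)|.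
  rewrite -(card_imset _ (can_inj mK)); apply: subset_leq_card.
  apply: (fintype.subset_trans (key _ _ c sm sm')).
  by apply/fintype.subsetP => y; rewrite inE => /andP[].
have h2 : #|P m' m (~~ c)| <= #|[set y in P m m' c | m' y != y]|.
  rewrite -(card_imset _ (can_inj m'K)); apply: subset_leq_card.
  by have := key _ _ (~~ c) sm' sm; rewrite negbK.
(* The inequality is strict because [x] belongs to the larger set but is unmatched in [m']. *)
have h3 : #|[set y in P m m' c | m' y != y]| < #|P m m' c|.
  apply: proper_card; apply/properP; split.
    by apply/fintype.subsetP => y; rewrite inE => /andP[].
  by exists x => //; rewrite inE m'x eqxx andbF.
by have := leq_ltn_trans (leq_trans h1 h2) h3; rewrite ltnn.
Qed.

Lemma stably_matchable_graph_mate x y : stably_matchable_graph x y ->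
  exists M, stable M /\ mate M x = y.
Proof.
case: x y => [s|r] [s'|r'] //= /existsP[M /andP[sM hM]]; exists M; split=> //.
  by apply/eqP; rewrite mate_inlE.
by apply/eqP; rewrite mate_inrE.
Qed.

Lemma mate_stably_matchable M x : stable M -> mate M x != x ->
  stably_matchable_graph x (mate M x).
Proof.
move=> sM; case: x => [s|r] /=; case: pickP => [y hy|]; rewrite ?eqxx // => _;
  by apply/existsP; exists M; rewrite sM.
Qed.

End StablePairs.

Lemma stably_matchable_no_articulation (V : finType) (e : rel V) :
  symmetric e -> irreflexive e -> bipartite e ->
  is_graph_of_stably_matchable_pairs e -> forall x, ~~ articulation_vertex e x.
Proof.
move=> e_sym e_irr [side bip] [I [f [g fK gK] fe]] x.
apply/nonarticulationP => // a b xa xb.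
have [Ma [sMa Ea]] : exists M, stable M /\ mate M (f x) = f a.
  by apply: stably_matchable_graph_mate; rewrite fe.
have [Mb [sMb Eb]] : exists M, stable M /\ mate M (f x) = f b.
  by apply: stably_matchable_graph_mate; rewrite fe.
(* The mates are pulled back along the isomorphism to involutions of [V]. *)
have mK M (sM : stable M) v : g (mate M (f (g (mate M (f v))))) = v.
  by have [mK _ _] := mate_stable sM; rewrite gK mK fK.
have neq M v : (g (mate M (f v)) != v) = (mate M (f v) != f v).
  by rewrite (can2_eq gK fK).
have me M (sM : stable M) v : g (mate M (f v)) != v -> e v (g (mate M (f v))).
  by rewrite neq -fe gK; apply: mate_stably_matchable.
have -> : a = g (mate Ma (f x)) by rewrite Ea fK.
have -> : b = g (mate Mb (f x)) by rewrite Eb fK.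
apply: (@matching_pair_connect _ _ side
  (fun v => g (mate Ma (f v))) (fun v => g (mate Mb (f v))) x bip).
- exact: mK.
- exact: mK.
- exact: me.
- exact: me.
- move=> v; rewrite !neq; apply/idP/idP; apply: stable_mate_matched;
  exact: mate_stable.
- by rewrite Ea fK; apply: contraTneq xa => ->; rewrite e_irr.
Qed.

(** * Spanning cycles without crossing chords *)

Section CyclesAndThetas.
Variables (V : finType) (e : rel V).
Hypotheses (e_sym : symmetric e) (e_irr : irreflexive e).

Lemma path_rcons_rev a b p : path e a (rcons p b) -> path e b (rcons (rev p) a).
Proof.
rewrite -rev_cons -(belast_rcons a p b) -{2}(last_rcons a p b) rev_path.
by apply: sub_path => x y; rewrite e_sym.
Qed.

Hypothesis theta_free : forall a b p1 p2 p3,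
  [&& p1 != [::], p2 != [::] & p3 != [::]] ->
  path e a (rcons p1 b) -> path e a (rcons p2 b) -> path e a (rcons p3 b) ->
  ~ uniq (a :: b :: p1 ++ p2 ++ p3).

(** The edge [xy] starts an ear that leaves the cycle at [x] and first returns at some [z]. If both
    arcs between [x] and [z] have internal vertices, they form a theta with the ear; otherwise the
    ear replaces an arc without internal vertices. *)
Lemma cycle_extend c x y :
  (forall a b, e x a -> e x b -> connect (delete_vertex e x) a b) ->
  ucycle e c -> 1 < size c -> x \in c -> y \notin c -> e x y ->
  exists c', [/\ ucycle e c', size c < size c' & {subset c <= c'}].
Proof.
move=> nbr /andP[cyc unq] c1 xc yc xy.
have [k c2 ck] := rot_to xc.
have {cyc} : cycle e (x :: c2) by rewrite -ck rot_cycle.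
have {unq} : uniq (x :: c2) by rewrite -ck rot_uniq.
have sc : size c = (size c2).+1 by rewrite -(size_rot k) ck.
have mc z : (z \in c) = (z \in x :: c2) by rewrite -ck mem_rot.
rewrite {}mc in yc; rewrite {}sc in c1 *.
suff : uniq (x :: c2) -> cycle e (x :: c2) ->
    exists c', [/\ ucycle e c', (size c2).+1 < size c' &
      {subset x :: c2 <= c'}].
  move=> + h1 h2 => /(_ h1 h2) [c' [h3 h4 h5]]; exists c'; split => // z.
  by rewrite -(mem_rot k) ck; apply: h5.
move=> {c k xc ck} unq cyc.
(* The successor of [x] on the cycle is a neighbour of [x], so [y] reaches it without [x]. *)
have xx1 : e x (head x c2) by move: cyc c1; case: (c2) => //= a l /andP[].
have /connectP[q0 pq0 lq0] := nbr _ _ xy xx1.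
case/shortenP: pq0 lq0 => q pq uq _ lq.
have {c1} lc : last y q \in c2.
  by rewrite -lq; move: c1; case: (c2) => //= a l _; rewrite mem_head.
have hasq : has (mem c2) q.
  case: (q) lc => [|a l] /=; first by move: yc;
    rewrite inE negb_or => /andP[_ /negPf->].
  by move=> h; rewrite -[_ || _]/(has (mem c2) (a :: l)); apply/hasP;
    exists (last a l) => //; exact: mem_last.
(* The first vertex of the path on the cycle ends the ear, so [q1] lies off the cycle. *)
pose i := find (mem c2) q; pose z := nth x q i.
have zc : z \in c2 by have := nth_find x hasq.
have iq : i < size q by rewrite -has_find.
have qE : q = take i q ++ z :: drop i.+1 q.
  by rewrite -{1}(cat_take_drop i q) (drop_nth x).
set q1 := take i q in qE; set q2 := drop i.+1 q in qE.
have q1c w : w \in q1 -> w \notin c2.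
  move=> /(nthP x)[j]; rewrite size_takel ?(ltnW iq) // => ji.
  by rewrite nth_take // => <-; have /= := before_find x ji; move=> ->.
have pe : path e y q by apply: sub_path pq => u v /and3P[].
have xq : x \notin y :: q.
  apply/negP; rewrite inE => /predU1P[xy1|xq']; first by move: yc;
    rewrite -xy1 mem_head.
  have : connect (delete_vertex e x) y x.
    by case/splitPr: xq' pq => l1 l2; rewrite cat_path => /andP[h1 /andP[h2 _]];
      apply/connectP; exists (rcons l1 x); rewrite ?last_rcons // rcons_path h1.
  have yx : y != x by apply: contraTneq xy => ->; rewrite e_irr.
  by move/delete_vertex_connect_neq => /(_ yx); rewrite eqxx.
pose P := y :: q1.
have pP : path e x (rcons P z).
  move: pe; rewrite qE /P -cat1s catA cat_path /= xy -cats1 => /andP[h _].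
  by move: h; rewrite cat_path /=.
have unP : uniq P.
  by move: uq; rewrite qE /P -cat_cons cat_uniq => /andP[].
have Pc w : w \in P -> w \notin x :: c2.
  rewrite /P inE => /predU1P[-> //|wq1]; rewrite inE negb_or q1c // andbT.
  by apply: contraNneq xq => <-; rewrite inE qE mem_cat wq1 orbT.
have Pn : P != [::] by [].
clearbody P; move: zc unq cyc Pc; clear -pP unP Pn theta_free e_sym.
case/splitPr=> A B unq cyc Pc.
have paths A0 B0 : cycle e (x :: A0 ++ z :: B0) ->
    path e x (rcons A0 z) /\ path e z (rcons B0 x).
  by rewrite /= rcons_cat rcons_cons -cat_rcons cat_path last_rcons => /andP[].
have [pA pB] := paths _ _ cyc.
have shortcut B0 : path e z (rcons B0 x) -> uniq (x :: z :: B0) ->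
    {in P, forall w, w \notin x :: z :: B0} -> ucycle e (x :: P ++ z :: B0).
  move=> pB0 uB0 dP; apply/andP; split.
    by rewrite /= rcons_cat rcons_cons -cat_rcons cat_path last_rcons pP pB0.
  have /= /and3P[] := uB0; rewrite inE negb_or => /andP[xz xB] zB uB.
  have nP w : w \in x :: z :: B0 -> w \notin P by apply: contraL; apply: dP.
  rewrite /= mem_cat negb_or nP ?mem_head // inE negb_or xz xB.
  rewrite cat_uniq unP cons_uniq zB uB !andbT andTb; apply/hasPn => w hw.
  by apply: nP; rewrite inE hw orbT.
have sPn : size P > 0 by case: (P) Pn.
have [A0|A0] := eqVneq A [::].
  subst A; exists (x :: P ++ z :: B); split; first exact: shortcut.
    by rewrite /= size_cat /= addnS !ltnS -{1}[size B]add0n ltn_add2r.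
  by move=> w; rewrite !inE mem_cat inE => /orP[] ->; rewrite ?orbT.
(* Here [z] is the predecessor of [x], and [A] is traversed backwards after the ear. *)
have [B0|B0] := eqVneq B [::].
  subst B; exists (x :: P ++ z :: rev A).
  have pA' : perm_eq (x :: z :: rev A) (x :: A ++ [:: z]).
    by rewrite perm_cons cats1 perm_sym perm_rcons perm_cons perm_sym perm_rev.
  have memA := perm_mem pA'.
  split.
  - apply: shortcut; first exact: path_rcons_rev.
      by rewrite (perm_uniq pA').
    by move=> w /Pc; rewrite memA.
  - by rewrite /= !size_cat /= size_rev addn1 addnS !ltnS -{1}[size A]add0n
    ltn_add2r.
  - move=> w; rewrite -memA !inE mem_cat inE.
    by case/or3P=> ->; rewrite ?orbT.
have [] := theta_free (a := x) (b := z) (p1 := A) (p2 := rev B) (p3 := P).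
- by rewrite A0 Pn -size_eq0 size_rev size_eq0 B0.
- exact: pA.
- exact: path_rcons_rev.
- exact: pP.
have : perm_eq (x :: z :: A ++ rev B ++ P) ((x :: A ++ z :: B) ++ P).
  rewrite /= perm_cons -!catA -cat1s perm_catCA perm_cat2l /= perm_cons.
  by rewrite perm_cat2r perm_rev.
move/perm_uniq => ->; rewrite cat_uniq unq unP andbT; apply/hasPn => w /Pc.
by [].
Qed.

(** A cycle through [v] that cannot be extended has no edge leaving it, hence fills the component.
    The size condition allows for isolated vertices, since [cycle e [:: v]] would require a loop. *)
Lemma hamiltonian_component v :
  (forall x, ~~ articulation_vertex e x) ->
  exists c, [/\ uniq c, c =i connect e v & 1 < size c -> cycle e c].
Proof.
move=> nart.
have nbr x := elimT (nonarticulationP e_sym e_irr x) (nart x).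
have [w vw|iso] := pickP (e v); last first.
  exists [:: v]; split=> // w; rewrite !inE; apply/eqP/idP => [->|].
    exact: connect0.
  by case/connectP=> -[|u p] //= /andP[]; rewrite iso.
(* An edge traversed back and forth counts as a cycle of length 2. *)
have {w vw} : exists2 c, ucycle e c & (1 < size c) && (v \in c).
  exists [:: v; w]; last by rewrite mem_head.
  rewrite /ucycle /= vw e_sym vw inE /= !andbT.
  by apply: contraTneq vw => ->; rewrite e_irr.
case=> c; have [n] := ubnP (#|V| - size c).
elim: n c => // n IH c cn uc /andP[c1 vc].
have [[x xc [y yc xy]]|noexit] :=
    pselect (exists2 x, x \in c & exists2 y, y \notin c & e x y).
  have [c' [uc' cc' sub]] := cycle_extend (nbr x) uc c1 xc yc xy.
  apply: (IH c') => //; last by rewrite (ltn_trans c1) // sub.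
  have : size c' <= #|V| by case/andP: uc' => _ /card_uniqP <-; apply: max_card.
  by move: cn cc'; lia.
exists c; case/andP: uc => cyc unq; split=> // w; apply/idP/idP => [wc|].
  have [k c2 ck] := rot_to vc.
  have : path e v (rcons c2 v) by rewrite -[path _ _ _]/(cycle e (v :: c2))
    -ck rot_cycle.
  move/path_connect; apply; change (w \in v :: rcons c2 v).
  by rewrite -rcons_cons mem_rcons inE -ck mem_rot wc orbT.
case/connectP=> p + ->; elim: p v vc {IH} => //= u p IHp v vc /andP[vu].
apply: IHp; apply/negPn/negP => uc; apply: noexit.
by exists v => //; exists u.
Qed.

(** If [A] were nonempty, there would be a theta between [u] and [x]: along [A], along the chord to
    [v] and back through [B], and back through [D] to [y] and along the chord [yx]. *)
Lemma crossing_chords_theta u x v y A B C D :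
  ucycle e (u :: A ++ x :: B ++ v :: C ++ y :: D) -> e u v -> e x y ->
  A = [::].
Proof.
case/andP=> cyc unq uv xy; apply/eqP/negPn/negP => A0.
move: cyc; rewrite /= rcons_cat rcons_cons rcons_cat rcons_cons rcons_cat
  rcons_cons.
rewrite -cat_rcons cat_path last_rcons => /andP[pA].
rewrite -cat_rcons cat_path last_rcons => /andP[pB].
rewrite -cat_rcons cat_path last_rcons => /andP[_ pD].
have [] := theta_free (a := u) (b := x) (p1 := A) (p2 := v :: rev B)
  (p3 := rcons (rev D) y).
- by rewrite A0 /=; case: (rev D).
- exact: pA.
- by rewrite /= uv path_rcons_rev.
- by rewrite rcons_path path_rcons_rev // last_rcons e_sym.
have : perm_eq (u :: A ++ x :: B ++ v :: C ++ y :: D)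
    ((u :: x :: A ++ (v :: rev B) ++ rcons (rev D) y) ++ C).
  apply/permP => p; rewrite /= !count_cat /= !count_cat /= !count_cat /=.
  by rewrite -!cats1 !count_cat /= !count_rev; lia.
by move/perm_uniq; rewrite unq cat_uniq => /esym/and3P[].
Qed.

(** The inequalities put [u], [x] and [v] on the cycle. They do not decide this for [y], because the
    index of an absent vertex is [size c]. *)
Lemma chords_noncrossing c u x v y :
  bipartite e -> ucycle e c -> e u v -> e x y ->
  index u c < index x c -> index x c < index v c -> index v c < index y c ->
  y \notin c.
Proof.
case=> side bip uc uv xy ux xv vy; apply/negP => yc.
have slice i z : i <= index z c -> z \in c ->
    drop i c = take (index z c - i) (drop i c) ++ z :: drop (index z c).+1 c.
  move=> iz zc; rewrite -[LHS](cat_take_drop (index z c - i)) drop_drop.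
  by rewrite subnK // [drop (index z c) c](drop_nth z) ?index_mem // nth_index.
have lt_mem a b : index a c < index b c -> a \in c.
  by move=> ab; rewrite -index_mem (leq_trans ab) // index_size.
have cE := slice 0 u (leq0n _) (lt_mem _ _ ux); rewrite drop0 subn0 in cE.
have := slice _ x ux (lt_mem _ _ xv); have := slice _ v xv (lt_mem _ _ vy).
have := slice _ y vy yc; move: cE; set C0 := take _ c.
set A := take _ (drop (index u c).+1 _);
  set B := take _ (drop (index x c).+1 _).
set C := take _ (drop (index v c).+1 _); set D := drop (index y c).+1 _.
move=> + E3 E2 E1; rewrite {}E1 {}E2 {}E3 => cE.
have {}uc : ucycle e (u :: A ++ x :: B ++ v :: C ++ y :: D ++ C0).
  move: uc; rewrite -(rot_ucycle (size C0)) {1}cE rot_size_cat.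
  by rewrite /= -!catA /= -!catA /= -!catA.
have A0 := crossing_chords_theta uc uv xy.
(* Rotated to start at [x], the cycle has the two chords in exchanged roles, so [B] is empty as well
   and [u], [x], [v] form a triangle. *)
have uc' : ucycle e (x :: B ++ v :: C ++ y :: (D ++ C0) ++ u :: A).
  rewrite -(rot_ucycle (size (u :: A))) in uc.
  by move: uc; rewrite -[u :: A ++ _]cat_cons rot_size_cat /= -!catA /=
    -!catA /= -!catA.
have B0 := crossing_chords_theta uc' xy (etrans (e_sym v u) uv).
case/andP: uc; rewrite A0 B0 /= => /andP[ux' /andP[xv' _]] _.
have := bip _ _ ux'; have := bip _ _ xv'; have := bip _ _ uv.
by case: (side u) (side x) (side v) => [] [] [].
Qed.

End CyclesAndThetas.

(** * Cyclic preferences *)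

(** The number of forward steps from [a] to [b] on a cycle with positions below [n]. *)
Definition step_dist (n a b : nat) : nat := if a <= b then b - a else n + b - a.

Lemma step_dist_lt n a b : a < n -> b < n -> step_dist n a b < n.
Proof. by rewrite /step_dist; case: ifP; lia. Qed.

Lemma step_dist_gt0 n a b : a < n -> b < n -> a <> b -> 0 < step_dist n a b.
Proof. by rewrite /step_dist; case: ifP; lia. Qed.

Lemma step_dist_inj n a b c : a < n -> b < n -> c < n ->
  step_dist n a b = step_dist n a c -> b = c.
Proof. by rewrite /step_dist; do 2 case: ifP; lia. Qed.

Lemma step_dist_succ n a b : a < n -> b < n ->
  step_dist n a (if b.+1 == n then 0 else b.+1) =
  if (step_dist n a b).+1 == n then 0 else (step_dist n a b).+1.
Proof. by rewrite /step_dist; do 2 case: ifP; do ? case: ifP; lia. Qed.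

Lemma step_dist1 n a : a < n -> 1 < n ->
  step_dist n a (if a.+1 == n then 0 else a.+1) = 1.
Proof. by rewrite /step_dist; do 2 case: ifP; lia. Qed.

(** Going forward from [b], one meets [a] before any position strictly between [a] and [b]. *)
Lemma step_dist_arc n a b c : a < n -> b < n -> c < n ->
  0 < step_dist n a c -> step_dist n a c < step_dist n a b ->
  step_dist n b c < step_dist n b a -> False.
Proof. by rewrite /step_dist; do ? case: ifP; lia. Qed.

(** The cyclic order [a], [c], [b], [k] becomes linear by cutting it at one of four places. *)
Lemma step_dist_cross n a b c k : a < n -> b < n -> c < n -> k < n ->
  0 < step_dist n a c -> step_dist n a c < step_dist n a b ->
  step_dist n a b < step_dist n a k ->
  [|| [&& a < c, c < b & b < k], [&& c < b, b < k & k < a],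
      [&& b < k, k < a & a < c] | [&& k < a, a < c & c < b]].
Proof. by rewrite /step_dist; do ? case: ifP; lia. Qed.

Section CyclicPreferences.
Variables (V : finType) (e : rel V) (side : V -> bool) (C : V -> seq V).
Hypotheses (e_sym : symmetric e) (e_irr : irreflexive e)
  (bip : forall u v, e u v -> side u != side v)
  (C_uniq : forall v, uniq (C v)) (C_mem : forall v, v \in C v)
  (C_eq : forall v w, w \in C v -> C w = C v)
  (C_edge : forall v w, e v w -> w \in C v)
  (C_cycle : forall v, 1 < size (C v) -> cycle e (C v))
  (C_noncrossing : forall c u x v y, e u v -> e x y ->
    index u (C c) < index x (C c) -> index x (C c) < index v (C c) ->
    index v (C c) < index y (C c) -> y \notin C c).

(** The rank of [y] in the preferences of [x], smaller being better. *)
Definition cyclic_dist x y : nat :=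
  step_dist (size (C x)) (index x (C x)) (index y (C x)).

Local Notation d := cyclic_dist.

Lemma index_C_lt x y : y \in C x -> index y (C x) < size (C x).
Proof. by rewrite index_mem. Qed.

Lemma cyclic_dist_inj x y z : y \in C x -> z \in C x -> d x y = d x z -> y = z.
Proof.
move=> yC zC dyz; apply: (index_inj x yC zC).
by apply: step_dist_inj dyz; rewrite index_C_lt.
Qed.

Lemma cyclic_dist_gt0 x y : y \in C x -> y != x -> 0 < d x y.
Proof.
move=> yC /eqP yx; apply: step_dist_gt0; rewrite ?index_C_lt //.
by move=> /(index_inj x (C_mem x) yC) xy; apply: yx.
Qed.

Lemma cyclic_distxx x : d x x = 0.
Proof. by rewrite /d /step_dist leqnn subnn. Qed.

Let nx x := next (C x) x.
Let pv x := prev (C x) x.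

Lemma nx_mem x : nx x \in C x. Proof. by rewrite mem_next. Qed.
Lemma pv_mem x : pv x \in C x. Proof. by rewrite mem_prev. Qed.

Lemma nxK x : pv (nx x) = x.
Proof. by rewrite /pv (C_eq (nx_mem x)) prev_next. Qed.

Lemma pvK x : nx (pv x) = x.
Proof. by rewrite /nx (C_eq (pv_mem x)) next_prev. Qed.

Lemma index_nx x : index (nx x) (C x) =
  if (index x (C x)).+1 == size (C x) then 0 else (index x (C x)).+1.
Proof.
rewrite /nx next_nth C_mem; move: (C_uniq x) (C_mem x).
case: (C x) => // y c unq xc.
have := xc; rewrite -index_mem => ilt.
case: ifP => ic; rewrite eqSS in ic.
  by rewrite nth_default ?index_head // (eqP ic).
have ic' : index x (y :: c) < size c by rewrite ltn_neqAle ic -ltnS.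
by rewrite -[nth y c _]/(nth y (y :: c) (index x (y :: c)).+1) index_uniq.
Qed.

Lemma cyclic_dist_nx u x : x \in C u ->
  d u (nx x) = if (d u x).+1 == size (C u) then 0 else (d u x).+1.
Proof.
move=> xC; rewrite /d -step_dist_succ ?index_C_lt //.
by rewrite -(C_eq xC) index_nx.
Qed.

Lemma size_C_gt1 x y : y \in C x -> y != x -> 1 < size (C x).
Proof.
move=> yC yx; rewrite -(card_uniqP (C_uniq x)); apply/card_gt1P.
by exists y, x.
Qed.

(** The successor is at distance 1: nobody matched to it can want to deviate. *)
Lemma nx_min x y : y \in C x -> y != x -> d x (nx x) <= d x y.
Proof.
move=> yC yx; rewrite {1}/d index_nx step_dist1 ?index_C_lt //.
  exact: cyclic_dist_gt0.
exact: size_C_gt1 yC yx.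
Qed.

Lemma nx_neq x y : y \in C x -> y != x -> nx x != x.
Proof.
move=> yC yx; apply/eqP => nxx; have := cyclic_distxx x.
rewrite -{2}nxx /d index_nx step_dist1 ?index_C_lt //.
exact: size_C_gt1 yC yx.
Qed.

Lemma nx_edge x : nx x != x -> e x (nx x).
Proof.
move=> nxx; apply: next_cycle (C_mem x).
exact: C_cycle (size_C_gt1 (nx_mem x) nxx).
Qed.

Lemma pv_edge x : pv x != x -> e x (pv x).
Proof.
move=> pvx; rewrite e_sym -{2}(pvK x); apply: nx_edge.
by rewrite pvK eq_sym.
Qed.

Variables (u v : V).
Hypothesis (uv : e u v).

(** The open forward arc from [u] to [v]; its complement also contains all other components. *)
Let inside x := [&& x \in C u, 0 < d u x & d u x < d u v].

(* [u] and [v] are matched together, and the two arcs of their cycle between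
   them are matched along the cycle; the agents matched to their successors,
   hence to their favourites, are those of one side in one arc and those of
   the other side in the other arc. *)
Definition cyclic_mate x : V :=
  if x == u then v else if x == v then u else
  if inside x != (side x == side u) then nx x else pv x.

Local Notation m := cyclic_mate.

Lemma vC : v \in C u. Proof. exact: C_edge. Qed.

Lemma nx_C x : x \in C u -> nx x \in C u.
Proof. by move=> xC; rewrite -(C_eq xC) nx_mem. Qed.

Lemma pv_C x : x \in C u -> pv x \in C u.
Proof. by move=> xC; rewrite -(C_eq xC) pv_mem. Qed.

Lemma vu : v != u.
Proof. by apply: contraTneq uv => ->; rewrite e_irr. Qed.

Lemma inside_nx x : inside x -> nx x = v \/ inside (nx x).
Proof.
case/and3P=> xC x0 xv.
have dn : d u (nx x) = (d u x).+1.
  (* The distance does not wrap around to 0, as [x] comes before [v]. *)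
  rewrite cyclic_dist_nx //; case: eqP => // xn.
  have : d u v < size (C u) by apply: step_dist_lt; rewrite index_C_lt // vC.
  by rewrite -xn ltnS leqNgt xv.
case: (eqVneq (nx x) v) => [|nv]; [by left | right].
rewrite /inside nx_C // dn /= ltn_neqAle xv andbT -dn.
by apply: contraNneq nv => /(cyclic_dist_inj (nx_C xC) vC)/eqP.
Qed.

Lemma inside_pv x : inside x -> pv x = u \/ inside (pv x).
Proof.
case/and3P=> xC x0 xv; have pC := pv_C xC.
case: (eqVneq (pv x) u) => [|nu]; [by left | right].
have := cyclic_dist_nx pC; rewrite pvK; case: eqP => [_ x0'|_ dx].
  by rewrite x0' in x0.
rewrite /inside pC cyclic_dist_gt0 //=.
by apply: leq_trans xv; rewrite dx ltnW.
Qed.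

Lemma nx_u : nx u = v \/ inside (nx u).
Proof.
have dn : d u (nx u) = 1.
  rewrite cyclic_dist_nx ?C_mem // cyclic_distxx.
  by have := size_C_gt1 vC vu; case: (size (C u)) => [|[]].
case: (eqVneq (nx u) v) => [|nv]; [by left | right].
rewrite /inside nx_C ?C_mem // dn /= ltn_neqAle cyclic_dist_gt0 ?vC ?vu //
  andbT.
by rewrite -dn; apply: contraNneq nv =>
  /(cyclic_dist_inj (nx_C (C_mem u)) vC)/eqP.
Qed.

Lemma pv_v : pv v = u \/ inside (pv v).
Proof.
case: (eqVneq (pv v) u) => [|nu]; [by left | right].
have pC := pv_C vC.
have := cyclic_dist_nx pC; rewrite pvK; case: eqP => [_ v0|_ dx].
  by have := cyclic_dist_gt0 vC vu; rewrite v0.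
by rewrite /inside pC cyclic_dist_gt0 //= dx.
Qed.

Lemma inside_u : inside u = false.
Proof. by rewrite /inside cyclic_distxx ltnn andbF. Qed.

Lemma inside_v : inside v = false.
Proof. by rewrite /inside ltnn !andbF. Qed.

Lemma sidev : side v = ~~ side u.
Proof. by have := bip uv; case: (side u) (side v) => [] []. Qed.

Lemma side_nx x : nx x != x -> side (nx x) = ~~ side x.
Proof. by move=> /nx_edge /bip; case: (side x) (side (nx x)) => [] []. Qed.

Lemma side_pv x : pv x != x -> side (pv x) = ~~ side x.
Proof. by move=> /pv_edge /bip; case: (side x) (side (pv x)) => [] []. Qed.

Lemma nx_fix x : (nx x == x) = (pv x == x).
Proof. by apply/eqP/eqP => h; [have := nxK x | have := pvK x]; rewrite h. Qed.

Lemma cyclic_mate_edge x : m x != x -> e x (m x).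
Proof.
rewrite /m; case: (eqVneq x u) => [->//|_].
case: (eqVneq x v) => [->|_]; first by rewrite e_sym.
by case: ifP => _; [exact: nx_edge | exact: pv_edge].
Qed.

Lemma cyclic_mate_matched x y : e x y -> m x != x.
Proof.
move=> xy; have yx : y != x by apply: contraTneq xy => ->; rewrite e_irr.
have nxx := nx_neq (C_edge xy) yx.
rewrite /m; case: (eqVneq x u) => [->|_]; first exact: vu.
case: (eqVneq x v) => [->|_]; first by rewrite eq_sym vu.
by case: ifP; rewrite -?nx_fix.
Qed.

(** Moving one step changes the side, so that the step prescribed for [x] never hits [u] or [v];
    hence it stays in the same arc, and there the rule for the other side is the step back. *)
Lemma cyclic_mateK x : m (m x) = x.
Proof.
rewrite {2}/m; case: (eqVneq x u) => [->|xu].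
  by rewrite /m eqxx (negPf vu).
case: (eqVneq x v) => [->|xv]; first by rewrite /m eqxx.
(* An isolated vertex is its own successor and predecessor, hence unmatched. *)
case: (eqVneq (nx x) x) => [nxx|nxx].
  have /eqP pxx : pv x == x by rewrite -nx_fix nxx.
  by rewrite nxx pxx if_same /m (negPf xu) (negPf xv) nxx pxx if_same.
have pxx : pv x != x by rewrite -nx_fix.
case: ifP => hx.
  have sn := side_nx nxx.
  suff [nu nv ins] : [/\ nx x != u, nx x != v & inside (nx x) = inside x].
    rewrite /m (negPf nu) (negPf nv) ins sn nxK.
    by move: hx; case: (inside x) (side x) (side u) => [] [] [].
  case ix : (inside x) hx => /= hx.
    have sxu : side x = ~~ side u by case: (side x) (side u) hx => [] [].
    have nv : nx x != v.
      by apply/eqP => h; move: sn; rewrite h sidev sxu; case: (side u).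
    have [nv'|ins] := inside_nx ix; first by rewrite nv' eqxx in nv.
    by split=> //; apply: contraTneq ins => ->; rewrite inside_u.
  have sxu : side x = side u by case: (side x) (side u) hx => [] [].
  split.
  - by apply/eqP => h; move: sn; rewrite h sxu; case: (side u).
  - apply: contraFneq ix => nv; have [] := pv_v; rewrite -nv nxK //.
    by move=> xu'; rewrite xu' eqxx in xu.
  - apply/negP => /inside_pv[]; rewrite nxK ?ix //.
    by move=> xu'; rewrite xu' eqxx in xu.
have sp := side_pv pxx.
suff [pu pv' ins] : [/\ pv x != u, pv x != v & inside (pv x) = inside x].
  rewrite /m (negPf pu) (negPf pv') ins sp pvK.
  by move: hx; case: (inside x) (side x) (side u) => [] [] [].
case ix : (inside x) hx => /= hx.
  have sxu : side x = side u by case: (side x) (side u) hx => [] [].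
  have pu : pv x != u by apply/eqP => h; move: sp; rewrite h sxu;
    case: (side u).
  have [pu'|ins] := inside_pv ix; first by rewrite pu' eqxx in pu.
  by split=> //; apply: contraTneq ins => ->; rewrite inside_v.
have sxu : side x = ~~ side u by case: (side x) (side u) hx => [] [].
split.
- apply: contraFneq ix => pu; have [] := nx_u; rewrite -pu pvK //.
  by move=> xv'; rewrite xv' eqxx in xv.
- by apply/eqP => h; move: sp; rewrite h sidev sxu; case: (side u).
- apply/negP => /inside_nx[]; rewrite pvK ?ix //.
  by move=> xv'; rewrite xv' eqxx in xv.
Qed.

(** Such an edge would cross [uv]; depending on where the list [C u] starts, [C_noncrossing] is
    applied to one of four arrangements of the two chords. *)
Lemma outside_crossing x y : e x y -> inside x -> ~~ inside y ->
  y != u -> y != v -> False.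
Proof.
move=> xy ix iy yu yv; case/and3P: (ix) => xC x0 xv.
have yC : y \in C u by rewrite -(C_eq xC) C_edge.
have : d u v < d u y.
  move: iy; rewrite /inside yC cyclic_dist_gt0 //= -leqNgt leq_eqVlt.
  by case/predU1P => // /(cyclic_dist_inj vC yC) vy; rewrite vy eqxx in yv.
have vu' : e v u by rewrite e_sym.
have yx : e y x by rewrite e_sym.
move/(step_dist_cross (index_C_lt (C_mem u)) (index_C_lt vC) (index_C_lt xC)
  (index_C_lt yC) x0 xv).
by case/or4P=> /and3P[h1 h2 h3]; [have := C_noncrossing uv xy h1 h2 h3 |
  have := C_noncrossing xy vu' h1 h2 h3 | have :=
    C_noncrossing vu' yx h1 h2 h3 |
  have := C_noncrossing yx uv h1 h2 h3]; rewrite ?yC ?xC ?vC ?C_mem.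
Qed.

(** A blocking pair contains nobody matched to a successor. A partner that [u] prefers to [v] lies
    inside the arc, one that [v] prefers to [u] lies outside, and both are matched to their
    successors, so [u] and [v] do not block. *)
Lemma cyclic_mate_stable x y : e x y -> m x != y ->
  d x y < d x (m x) -> d y x < d y (m y) -> False.
Proof.
have next_happy z w : e z w -> m z = nx z -> d z w < d z (m z) -> False.
  move=> zw ->; rewrite ltnNge nx_min ?C_edge //.
  by apply: contraTneq zw => ->; rewrite e_irr.
have u_case z : e u z -> z != v -> d u z < d u v -> d z u < d z (m z) -> False.
  move=> uz zv dz; have zu : z != u by apply: contraTneq uz => ->;
    rewrite e_irr.
  have iz : inside z by rewrite /inside C_edge // cyclic_dist_gt0 ?C_edge.
  apply: next_happy; first by rewrite e_sym.
  rewrite /m (negPf zu) (negPf zv) iz; have := bip uz.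
  by case: (side z) (side u) => [] [].
have v_case z : e v z -> z != u -> d v z < d v u -> d z v < d z (m z) -> False.
  move=> vz zu dz; have zv : z != v by apply: contraTneq vz => ->;
    rewrite e_irr.
  have iz : inside z = false.
    apply/negP => /and3P[zC z0 zv']; move: dz.
    rewrite /d (C_eq vC).
    exact: step_dist_arc (index_C_lt (C_mem u)) (index_C_lt vC) (index_C_lt
      zC) z0 zv'.
  apply: next_happy; first by rewrite e_sym.
  rewrite /m (negPf zu) (negPf zv) iz; have := bip vz; rewrite sidev.
  by case: (side z) (side u) => [] [].
have mu : m u = v by rewrite /m eqxx.
have mv : m v = u by rewrite /m eqxx (negPf vu).
move=> xy mxy dx dy.
have mxy' : m y != x by apply: contraNneq mxy => <-; rewrite cyclic_mateK.
case: (eqVneq x u) => [xu|xu].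
  rewrite xu in xy mxy dx dy; rewrite mu in mxy dx.
  by apply: u_case xy _ dx dy; rewrite eq_sym.
case: (eqVneq x v) => [xv|xv].
  rewrite xv in xy mxy dx dy; rewrite mv in mxy dx.
  by apply: v_case xy _ dx dy; rewrite eq_sym.
have yx : e y x by rewrite e_sym.
case: (eqVneq y u) => [yu|yu].
  rewrite yu in yx mxy' dx dy; rewrite mu in mxy' dy.
  by apply: u_case yx _ dy dx; rewrite eq_sym.
case: (eqVneq y v) => [yv|yv].
  rewrite yv in yx mxy' dx dy; rewrite mv in mxy' dy.
  by apply: v_case yx _ dy dx; rewrite eq_sym.
have mx : m x = if inside x != (side x == side u) then nx x else pv x.
  by rewrite /m (negPf xu) (negPf xv).
have my : m y = if inside y != (side y == side u) then nx y else pv y.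
  by rewrite /m (negPf yu) (negPf yv).
(* In the remaining case both are matched to predecessors. Being on different sides, they lie in
   different arcs, so their edge crosses [uv]. *)
case: ifP mx => hx mx; first exact: next_happy xy mx dx.
case: ifP my => hy my; first exact: next_happy yx my dy.
have := bip xy; move: hx hy.
case ix : (inside x); case iy : (inside y);
  try by case: (side x) (side y) (side u) => [] [] [].
- by move=> _ _ _; apply: outside_crossing xy ix _ yu yv; rewrite iy.
- by move=> _ _ _; apply: outside_crossing yx iy _ xu xv; rewrite ix.
Qed.

End CyclicPreferences.

(** * Stable matching instances from ranked bipartite graphs *)

Section InstanceOfPreferences.
Variables (V : finType) (e : rel V) (side : V -> bool) (d : V -> V -> nat).
Hypotheses (e_sym : symmetric e)
  (bip : forall u v, e u v -> side u != side v)
  (d_inj : forall x y z, e x y -> e x z -> d x y = d x z -> y = z).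

Definition preference_list x : seq V :=
  sort (fun y z => d x y <= d x z) [seq y <- enum V | e x y].

Lemma preference_list_uniq x : uniq (preference_list x).
Proof. by rewrite sort_uniq filter_uniq ?enum_uniq. Qed.

Lemma mem_preference_list x y : (y \in preference_list x) = e x y.
Proof. by rewrite mem_sort mem_filter mem_enum andbT. Qed.

Lemma prefers_preference_list x y z :
  prefers (preference_list x) y z -> d x y < d x z.
Proof.
case/and3P=> yx zx yz.
have srt : sorted (fun y z => d x y <= d x z) (preference_list x).
  by apply: sort_sorted => ? ?; apply: leq_total.
have tr : transitive (fun y z => d x y <= d x z) by move=> ? ? ?;
  apply: leq_trans.
rewrite ltn_neqAle (sorted_ltn_index tr srt _ _ yx zx yz) andbT.
rewrite !mem_preference_list in yx zx.
by apply: contraTneq yz => /(d_inj yx zx) ->; rewrite ltnn.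
Qed.

Lemma prefers_pmap_insub (P : pred V) (l : seq V) (y z : {x | P x}) :
  prefers (pmap insub l) y z -> prefers l (val y) (val z).
Proof.
rewrite /prefers !mem_pmap_sub => /and3P[-> -> /=].
elim: l => //= x l IH; case: insubP => [w Pw wx|nPx] /=.
  rewrite -wx !(inj_eq val_inj).
  by case: (w == y); case: (w == z) => //; rewrite !ltnS.
move/IH; have ne (w : {x | P x}) : (x == val w) = false.
  by apply: contraNF nPx => /eqP ->; apply: valP.
by rewrite !ne ltnS.
Qed.

Lemma pmap_insub_uniq (P : pred V) x :
  uniq (pmap insub (preference_list x) : seq {y | P y}).
Proof. exact: pmap_sub_uniq (preference_list_uniq x). Qed.

Definition preference_instance : instance :=
  @Instance {x | side x} {x | ~~ side x}
  (fun s => pmap insub (preference_list (val s)))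
  (fun r => pmap insub (preference_list (val r)))
  (fun s => pmap_insub_uniq _ (val s)) (fun r => pmap_insub_uniq _ (val r)).

Local Notation I := preference_instance.

Lemma preference_acceptable (s : student I) (r : residency I) :
  acceptable s r = e (val s) (val r).
Proof.
by rewrite /acceptable !mem_pmap_sub !mem_preference_list [e (val r) _]e_sym
  andbb.
Qed.

(** Every vertex with an edge is matched, so each member of a blocking pair would strictly prefer
    the other to its mate. *)
Lemma preference_stable (m : V -> V) :
  (forall x, m (m x) = x) -> (forall x, m x != x -> e x (m x)) ->
  (forall x y, e x y -> m x != x) ->
  (forall x y, e x y -> m x != y ->
     d x y < d x (m x) -> d y x < d y (m y) -> False) ->
  stable [set p : student I * residency I | m (val p.1) == val p.2].
Proof.
move=> mK me matched st; apply/and3P; split.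
- apply/forall_inP => -[s r]; rewrite inE /= => /eqP sr.
  apply/forall_inP => -[s' r']; rewrite inE /= => /eqP sr'; apply/implyP.
  rewrite xpair_eqE => /orP[/eqP ss|/eqP rr].
    by subst s'; rewrite eqxx /=; apply/eqP/val_inj; rewrite /= -sr -sr'.
  subst r'; rewrite eqxx andbT; apply/eqP/val_inj => /=.
  by rewrite -[LHS]mK -[RHS]mK sr sr'.
- apply/forall_inP => -[s r]; rewrite inE /= => /eqP sr.
  rewrite preference_acceptable /= -sr me // sr.
  by apply/eqP => rs; have := valP r; rewrite /= rs (valP s).
apply/forallP => s; apply/forallP => r; apply/negP.
case/and4P; rewrite preference_acceptable inE /= => sr nM ds dr.
apply: (st _ _ sr nM).
- have ms : ~~ side (m (val s)).
    by have := bip (me _ (matched _ _ sr)); rewrite (valP s);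
      case: (side (m _)).
  (* The mate of [s] is a residency by bipartiteness, which refutes that [s] is unmatched. *)
  case/orP: ds => [/forallP /(_ (exist (fun x => ~~ side x) _ ms))|];
    first by rewrite inE eqxx.
  case/existsP=> r'; rewrite inE /= => /andP[/eqP ->] /prefers_pmap_insub.
  exact: prefers_preference_list.
- have rs : e (val r) (val s) by rewrite e_sym.
  have mr : side (m (val r)).
    by have := bip (me _ (matched _ _ rs)); rewrite (negPf (valP r));
      case: (side (m _)).
  case/orP: dr => [/forallP /(_ (exist (fun x => side x) _ mr))|];
    first by rewrite inE /= mK eqxx.
  case/existsP=> s'; rewrite inE /= => /andP[/eqP sr'].
  by move=> /prefers_pmap_insub /prefers_preference_list; rewrite -sr' mK.
Qed.

(** Stable pairs are acceptable, hence edges; conversely it suffices to give one stable matching for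
    each edge. *)
Lemma preference_instance_graph :
  (forall u v, e u v -> exists m : V -> V,
    [/\ m u = v, forall x, m (m x) = x, forall x, m x != x -> e x (m x),
        forall x y, e x y -> m x != x &
        forall x y, e x y -> m x != y ->
          d x y < d x (m x) -> d y x < d y (m y) -> False]) ->
  is_graph_of_stably_matchable_pairs e.
Proof.
move=> mates; exists preference_instance.
pose g (w : {x | side x} + {x | ~~ side x}) :=
  match w with inl s => val s | inr r => val r end.
pose f v : {x | side x} + {x | ~~ side x} :=
  match boolP (side v) with
  | AltTrue h => inl (exist _ v h) | AltFalse h => inr (exist _ v h) end.
have fK : cancel f g by move=> v; rewrite /f; case: {-}_ / boolP.
have g_inj : injective g.
  move=> [s|r] [s'|r'] /= E; try by congr (_ _); apply: val_inj.
    by have := valP s; rewrite /= E (negPf (valP r')).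
  by have := valP s'; rewrite /= -E (negPf (valP r)).
have gK : cancel g f := inj_can_sym fK g_inj.
have edge (s : student I) (r : residency I) :
    stably_matchable s r = e (val s) (val r).
  apply/existsP/idP => [[M /andP[/and3P[_ /forall_inP acc _]]]|sr].
    by move/acc; rewrite preference_acceptable.
  have [m [ms mK me matched st]] := mates _ _ sr.
  exists [set p : student I * residency I | m (val p.1) == val p.2].
  by rewrite (preference_stable mK me matched st) inE /= ms eqxx.
have same b x y : side x = b -> side y = b -> e x y = false.
  by move=> xb yb; apply/negP => /bip; rewrite xb yb eqxx.
exists f; first by exists g.
move=> u v; rewrite -{2}(fK u) -{2}(fK v).
case: (f u) (f v) => [s|r] [s'|r'] /=.
- by rewrite (same true) ?(valP s) ?(valP s').
- exact: edge.
- by rewrite edge e_sym.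
- by rewrite (same false) //; apply: negbTE;
  [exact: (valP r) | exact: (valP r')].
Qed.

End InstanceOfPreferences.

Theorem theorem9 (R : realType) (V : finType) (e : rel V)
  (e_sym : symmetric e) (e_irr : irreflexive e)
  (e_bip : bipartite e) (e_out : outerplanar R e) :
  is_graph_of_stably_matchable_pairs e <->
  (forall x : V, ~~ articulation_vertex e x).
Proof.
split; first exact: stably_matchable_no_articulation.
move=> nart; have [side bip] := e_bip.
have theta_free a b p1 p2 p3 :=
  @outerplanar_theta_free R V e a b p1 p2 p3 e_out.
have [K HK] := choice (fun v =>
  hamiltonian_component e_sym e_irr theta_free v nart).
(* Choosing the cycle at the root gives all vertices of a component the same list, with the same
   starting point. *)
pose C v := K (fingraph.root e v).
have cs := sym_connect_sym e_sym.
have C_uniq v : uniq (C v) by have [] := HK (fingraph.root e v).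
have C_conn v w : (w \in C v) = connect e v w.
  have [_ -> _] := HK (fingraph.root e v).
  by rewrite -topredE /= -(same_connect cs (connect_root e v)).
have C_mem v : v \in C v by rewrite C_conn connect0.
have C_eq v w : w \in C v -> C w = C v.
  by rewrite C_conn -(root_connect cs) => /eqP vw; rewrite /C vw.
have C_edge v w : e v w -> w \in C v by rewrite C_conn => /connect1.
have C_cycle v : 1 < size (C v) -> cycle e (C v).
  by have [] := HK (fingraph.root e v).
have C_nc c u x v y : e u v -> e x y ->
    index u (C c) < index x (C c) -> index x (C c) < index v (C c) ->
    index v (C c) < index y (C c) -> y \notin C c.
  move=> uv xy ux xv vy; case: (ltnP 1 (size (C c))) => [c1|c1].
    apply: (chords_noncrossing e_sym theta_free e_bip _ uv xy ux xv vy).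
    by rewrite /ucycle C_cycle ?C_uniq.
  (* In a list with at most one entry, a positive index means absence. *)
  by rewrite -index_mem -leqNgt (leq_trans c1) // (leq_ltn_trans _ vy).
apply: (@preference_instance_graph _ e side (cyclic_dist C)) => //.
  by move=> x y z xy xz; apply: cyclic_dist_inj; rewrite ?C_edge.
move=> u v uv; exists (cyclic_mate side C u v); split.
- by rewrite /cyclic_mate eqxx.
- exact: cyclic_mateK.
- exact: cyclic_mate_edge.
- exact: cyclic_mate_matched.
- exact: cyclic_mate_stable.
Qed.
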